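(* If the Markov random cocycle $(\underline A,P,q)$ has both singular (rank one) and invertible components and $P$ is primitive, then $$L_1(\underline A)=\int_{\mathscr{A}\times\mathbb{P}^1}\Psi\,d\eta,\qquad\text{where}\quad \Psi(j,\hat v)=\sum_{i\in\mathscr{A}}p_{ij}\log\frac{\|A_iv\|}{\|v\|}\in[-\infty,\infty),$$ and $\eta$ is the unique $\mathcal{Q}$-stationary probability measure.
   Context: $\mathscr{A}=\{1,\dots,k\}=\mathscr{A}_{\mathrm{sing}}\sqcup\mathscr{A}_{\mathrm{inv}}$ both nonempty; $\mathrm{rank}A_i=1$ ($i\in\mathscr{A}_{\mathrm{sing}}$), $A_i$ invertible ($i\in\mathscr{A}_{\mathrm{inv}}$). $P=(p_{ij})$ primitive left stochastic ($p_{ij}$ = probability of $j\to i$), $Pq=q$, $\mu$ the associated Markov measure on $\mathscr{A}^{\mathbb{Z}}$, $L_1(\underline A)=\lim_n\frac1n\log\|A_{\omega_n}\cdots A_{\omega_1}\|$ $\mu$-a.e. Projective action: $\hat A\hat v=\widehat{Av}$ for invertible $A$, constant map to $\widehat{\mathrm{Range}A}$ for rank one $A$. $(\mathcal{Q}\varphi)(j,\hat v)=\sum_i\varphi(i,\hat A_i\hat v)p_{ij}$; $\eta$ stationary means $\int\mathcal{Q}\varphi\,d\eta=\int\varphi\,d\eta$ for bounded measurable $\varphi$. Explicitly $\eta=\sum_jq_j\delta_j\times\eta_j$ with $\eta_j=\frac1{q_j}\sum_{s\in\mathscr{A}_{\mathrm{sing}}}q_s\sum_{n\ge1}\sum_{\underline\omega\in\mathscr{B}_n(s,j)}p(\underline\omega)\delta_{\hat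 A^n(\underline\omega)\hat r_s}$ ($\mathscr{B}_n(s,j)$: words $(\omega_0,\dots,\omega_n)$, $\omega_0=s,\omega_n=j$, interior letters in $\mathscr{A}_{\mathrm{inv}}$; $A^n(\underline\omega)=A_{\omega_n}\cdots A_{\omega_1}$; $p(\underline\omega)=\prod p_{\omega_l\omega_{l-1}}$; $r_s$ the range of $A_s$). *)

(* Defs.v *)
From HB Require Import structures.
From mathcomp Require Import all_boot all_order all_algebra.
From mathcomp Require Import all_classical all_reals all_analysis.
Set Implicit Arguments. Unset Strict Implicit. Unset Printing Implicit Defensive.
Import Order.TTheory GRing.Theory Num.Theory.
Import numFieldNormedType.Exports.
Local Open Scope classical_set_scope.
Local Open Scope ring_scope.

Definition alph (k : nat) : Type := 'I_k.+1.
HB.instance Definition _ k := Finite.on (alph k).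
HB.instance Definition _ k := isPointed.Build (alph k) ord0.
HB.instance Definition _ k := @isMeasurable.Build default_measure_display
  (alph k) discrete_measurable discrete_measurable0
  discrete_measurableC discrete_measurableU.

Section P1.
Variable R : realType.
Definition vnorm (v : 'cV[R]_2) : R := Num.sqrt (v 0 0 ^+ 2 + v 1 0 ^+ 2).
Definition canon (v : 'cV[R]_2) : bool :=
  (vnorm v == 1) && ((0 < v 1 0) || ((v 1 0 == 0) && (0 < v 0 0))).
Definition e1 : 'cV[R]_2 := \col_i (if i == 0 then 1 else 0).
Lemma canon_e1 : canon e1.
Proof.
rewrite /canon /vnorm !mxE /=.
by rewrite expr0n /= addr0 expr1n sqrtr1 eqxx /= ltxx eqxx ltr01.
Qed.
Record P1type := P1pt { p1v :> 'cV[R]_2; p1vP : canon p1v }.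
HB.instance Definition _ := [isSub for p1v].
HB.instance Definition _ := [Choice of P1type by <:].
HB.instance Definition _ := isPointed.Build P1type (P1pt canon_e1).
Definition P1emb (x : P1type) : R * R := (p1v x 0 0, p1v x 1 0).
Definition P1 : Type := g_sigma_algebra_preimageType P1emb.
HB.instance Definition _ := Pointed.on P1.
HB.instance Definition _ := Measurable.on P1.
End P1.

Section Cocycle.
Variable R : realType.
Variable k : nat.

(* canonical point of P^1 of a vector (arbitrary point for v = 0) *)
Definition lineof (v : 'cV[R]_2) : P1 R :=
  let u := (vnorm v)^-1 *: v in
  let w := if canon u then u else - u in
  insubd (point : P1type R) w.

Definition rangevec (M : 'M[R]_2) : 'cV[R]_2 :=
  if col 0 M != 0 then col 0 M else col 1 M.

Definition pact (M : 'M[R]_2) (x : P1 R) : P1 R :=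
  if \rank M == 1%N then lineof (rangevec M) else lineof (M *m p1v x).

Definition opnorm (M : 'M[R]_2) : R :=
  sup [set vnorm (M *m v) | v in [set v | vnorm v = 1]].

Definition elog (x : R) : \bar R := if x == 0 then -oo%E else (ln x)%:E.

Variables (p : alph k -> alph k -> R) (A : alph k -> 'M[R]_2).

Definition Psi (z : alph k * P1 R) : \bar R :=
  (\sum_(i : alph k) (p i z.1)%:E * elog (vnorm (A i *m p1v z.2) / vnorm (p1v z.2)))%E.

Definition Qop (phi : alph k * P1 R -> R) (z : alph k * P1 R) : R :=
  \sum_(i : alph k) phi (i, pact (A i) z.2) * p i z.1.

Definition Q_stationary (eta : probability (alph k * P1 R)%type R) : Prop :=
  forall phi : alph k * P1 R -> R,
    measurable_fun setT phi -> (exists M : R, forall z, `|phi z| <= M) ->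
    (\int[eta]_z (Qop phi z)%:E = \int[eta]_z (phi z)%:E)%E.

(* X is a Markov chain with transition probabilities p (p i j = P(j -> i))
   and initial distribution q *)
Definition markov_chain d (Omega : measurableType d) (Pr : probability Omega R)
    (q : alph k -> R) (X : nat -> Omega -> alph k) : Prop :=
  (forall n, measurable_fun setT (X n)) /\
  forall (n : nat) (w : nat -> alph k),
    Pr [set o | forall l, (l <= n)%N -> X l o = w l] =
      (q (w 0%N) * \prod_(l < n) p (w l.+1) (w l))%:E.

Fixpoint cocycle_prod T (X : nat -> T -> alph k) (n : nat) (o : T) : 'M[R]_2 :=
  match n with
  | 0 => 1%:M
  | n'.+1 => A (X n'.+1 o) *m cocycle_prod X n' o
  end.

Definition left_stochastic : Prop :=
  (forall i j, 0 <= p i j) /\ (forall j, \sum_(i : alph k) p i j = 1).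

Definition primitive : Prop :=
  exists m : nat, forall i j : alph k,
    0 < (((\matrix_(i0 < k.+1, j0 < k.+1) p i0 j0) : 'M[R]_k.+1) ^+ m) i j.

End Cocycle.

(* Main.v *)
(** From the first singular letter on, the cocycle is a rank one matrix whose
    range is carried by a direction [V_n], and (letter, direction) is a Markov
    chain with operator [Q]; so log ||A^n|| is, up to a constant, the sum of
    log ||A_(X_(l+1)) V_l||.

    Primitivity and the presence of a singular letter give a Doeblin
    condition: a fixed power of [Q] contracts the oscillation of bounded
    functions. Hence the stationary measure is unique, and, since empirical
    averages of [u] and [Q u] differ by a martingale average tending to [0]
    (fourth moments and Borel-Cantelli), bounded functions satisfy the law of
    large numbers.

    The logarithm is unbounded below, possibly not even integrable. Truncating
    it at [-L] gives the upper bound. When the integral is finite, the error of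
    truncation is controlled by the maximal ergodic inequality, proved by
    Wiener's covering argument on the finite words of the chain. *)

Require Import Defs.
From HB Require Import structures.
From mathcomp Require Import all_boot all_order all_algebra.
From mathcomp Require Import all_classical all_reals all_analysis.
From mathcomp Require Import measurable_realfun ring lra zify.
Import Order.TTheory GRing.Theory Num.Theory.
Import numFieldNormedType.Exports.
Local Open Scope classical_set_scope.
Local Open Scope ring_scope.

Set Implicit Arguments.
Unset Strict Implicit.

(** The initial direction is arbitrary, so the pair (letter, direction) is not stationary along the
    chain and an ergodic theorem does not apply to it directly. Only the letters are stationary, but
    from a singular letter on the direction is a function of the letters alone. The maximal
    inequality is therefore proved for functions of finite words, and applied to nonnegative
    functions that vanish until a singular letter has been seen: appending older letters can only
    increase them, and their means are dominated by integrals against the stationary measure. The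
    part of the logarithm below [-L] is always measured between two levels [L] and [L + L'], with
    bounds uniform in [L']. Every function stays bounded, and even the fact that no factor vanishes
    is deduced from the bound. The contraction is used for uniqueness; existence comes from a series
    indexed by the age of the last singular letter. Its total mass is one because the probability of
    meeting no singular letter decays geometrically. *)

(** * Expectations over finite words: maximal inequality and martingale moments *)

Section MarkovWords.
Variables (R : realType) (S : finType) (s0 : S).
Variables (p : S -> S -> R) (q : S -> R).
Hypothesis p_ge0 : forall i j, 0 <= p i j.
Hypothesis p_sum1 : forall j, \sum_i p i j = 1.
Hypothesis q_ge0 : forall j, 0 <= q j.
Hypothesis q_sum1 : \sum_j q j = 1.
Hypothesis q_stat : forall i, \sum_j p i j * q j = q i.

Definition predict (F : seq S -> R) (w : seq S) : R :=
  \sum_i p i (head s0 w) * F (i :: w).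

(* Words list the most recent letter first. *)
Fixpoint Ew (n : nat) (F : seq S -> R) : R :=
  if n is n'.+1 then Ew n' (predict F) else \sum_j q j * F [:: j].

Lemma EwS n F : Ew n.+1 F = Ew n (predict F).
Proof. by []. Qed.

Lemma Ew_le n F G : (forall w, size w = n.+1 -> F w <= G w) -> Ew n F <= Ew n G.
Proof.
elim: n F G => [|n IH] F G FG /=.
  by apply: ler_sum => j _; apply: ler_wpM2l; rewrite ?FG.
by apply: IH => w sw; apply: ler_sum => j _; apply: ler_wpM2l; rewrite ?FG //= sw.
Qed.

Lemma eq_Ew n F G : (forall w, size w = n.+1 -> F w = G w) -> Ew n F = Ew n G.
Proof.
by move=> FG; apply/eqP; rewrite eq_le !Ew_le // => w /FG ->.
Qed.

Lemma EwD n F G : Ew n (fun w => F w + G w) = Ew n F + Ew n G.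
Proof.
elim: n F G => [|n IH] F G /=.
  by rewrite -big_split; apply: eq_bigr => j _; rewrite mulrDr.
rewrite -IH; apply: eq_Ew => w _; rewrite /predict -big_split.
by apply: eq_bigr => j _; rewrite mulrDr.
Qed.

Lemma EwZ n c F : Ew n (fun w => c * F w) = c * Ew n F.
Proof.
elim: n F => [|n IH] F /=.
  by rewrite mulr_sumr; apply: eq_bigr => j _; rewrite mulrCA.
rewrite -IH; apply: eq_Ew => w _; rewrite /predict mulr_sumr.
by apply: eq_bigr => j _; rewrite mulrCA.
Qed.

Lemma predict_cst c w : predict (fun=> c) w = c.
Proof. by rewrite /predict -mulr_suml p_sum1 mul1r. Qed.

Lemma Ew_cst n c : Ew n (fun=> c) = c.
Proof.
elim: n => [|n IH] /=; first by rewrite -mulr_suml q_sum1 mul1r.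
by rewrite -[RHS]IH; apply: eq_Ew => w _; rewrite predict_cst.
Qed.

Lemma Ew_sum n (I : Type) (r : seq I) (F : I -> seq S -> R) :
  Ew n (fun w => \sum_(i <- r) F i w) = \sum_(i <- r) Ew n (F i).
Proof.
elim: r => [|i r IH].
  rewrite big_nil -[RHS](Ew_cst n 0).
  by apply: eq_Ew => w _; rewrite big_nil.
by rewrite big_cons -IH -EwD; apply: eq_Ew => w _; rewrite big_cons.
Qed.

Lemma Ew_drop m n F : Ew (m + n) (fun w => F (drop m w)) = Ew n F.
Proof.
elim: m => [|m IH]; first by apply: eq_Ew => w _; rewrite drop0.
rewrite -[RHS]IH addSn /=; apply: eq_Ew => w _.
by rewrite /predict /= -mulr_suml p_sum1 mul1r.
Qed.

Lemma Ew_head n (f : S -> R) : Ew n (fun w => f (head s0 w)) = \sum_j q j * f j.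
Proof.
elim: n f => [|n IH] f //=.
rewrite /predict /= (IH (fun j => \sum_i p i j * f i)) /=.
under eq_bigr do rewrite mulr_sumr.
rewrite exchange_big; apply: eq_bigr => i _ /=.
by rewrite -q_stat mulr_suml; apply: eq_bigr => j _; rewrite mulrCA mulrA.
Qed.

(** Discarding the oldest letter shifts the starting time, so this rests on stationarity of [q];
    discarding recent letters, as in [Ew_drop], rests on transition probabilities summing to one. *)
Lemma Ew_take1 n F : Ew n.+1 (fun w => F (take n.+1 w)) = Ew n F.
Proof.
elim: n F => [|n IH] F.
  rewrite -[RHS](Ew_head 1 (fun i => F [:: i])).
  by apply: eq_Ew => -[|i w] //= _; rewrite take0.
rewrite [LHS]EwS [RHS]EwS -[RHS]IH; apply: eq_Ew => w sw; apply: eq_bigr => i _.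
by case: w sw.
Qed.

Lemma Ew_take n m F : Ew (n + m) (fun w => F (take n.+1 w)) = Ew n F.
Proof.
elim: m => [|m IH].
  by rewrite addn0; apply: eq_Ew => w sw; rewrite take_oversize // sw.
rewrite -[RHS]IH addnS -[RHS]Ew_take1; apply: eq_Ew => w sw.
by rewrite take_takel // ltnS leq_addr.
Qed.

(* Wiener's covering argument: the windows starting at points of B are
   charged greedily from left to right. *)
Lemma covering_sum (r : nat -> R) (lam : R) (N : nat) (B : pred nat) :
  (forall l, 0 <= r l) -> 0 <= lam ->
  (forall a, B a -> exists2 n, (n < N)%N &
    lam * n.+1%:R <= \sum_(0 <= l < n.+1) r (a + l)%N) ->
  forall L a, lam * \sum_(a <= i < L) (B i)%:R <= \sum_(a <= l < L + N) r l.
Proof.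
move=> r0 lam0 HB L a.
have [k] := ubnP (L - a); elim: k a => // k IH a lek.
have [leLa|ltaL] := leqP L a.
  by rewrite big_geq // mulr0 sumr_ge0.
have [Ba|nBa] := boolP (B a); last first.
  rewrite big_ltn // (negbTE nBa) add0r [leRHS]big_ltn; last by lia.
  by apply: le_trans (IH a.+1 _) _; [lia|rewrite lerDr].
have [n ltnN Hn] := HB a Ba.
have -> : \sum_(a <= l < L + N) r l =
  \sum_(a <= l < a + n.+1) r l + \sum_(a + n.+1 <= l < L + N) r l.
  by rewrite -big_cat_nat //; lia.
have e1 : \sum_(a <= l < a + n.+1) r l = \sum_(0 <= l < n.+1) r (a + l)%N.
  by rewrite -{1}(add0n a) big_addn addKn; apply: eq_bigr => i _; rewrite addnC.
rewrite e1.
(* The window may run past [L]; the extra [N] terms on the right pay for it. *)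
have [leL|ltL] := leqP L (a + n.+1).
  apply: le_trans (_ : lam * n.+1%:R <= _); last first.
    by apply: le_trans Hn _; rewrite lerDl sumr_ge0.
  apply: ler_wpM2l => //; apply: le_trans (_ : \sum_(a <= i < L) 1 <= _).
    by apply: ler_sum => i _; case: (B i).
  by rewrite sumr_const_nat ler_nat; lia.
rewrite (big_cat_nat (n := a + n.+1)) //=; [|lia|lia].
rewrite mulrDr; apply: lerD; last by apply: IH; lia.
apply: le_trans Hn; apply: ler_wpM2l => //.
apply: le_trans (_ : \sum_(a <= i < a + n.+1) 1 <= _).
  by apply: ler_sum => i _; case: (B i).
by rewrite sumr_const_nat ler_nat; lia.
Qed.

(** In a word of size [N.+1], [drop (N - l.+1) w] is the history at time [l.+1]; all windows start
    at the oldest letter and run forward in time. *)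
Definition exceeds (y : seq S -> R) (lam : R) (N : nat) (w : seq S) : bool :=
  [exists n : 'I_N, lam * n.+1%:R < \sum_(0 <= l < n.+1) y (drop (N - l.+1) w)].

(** Integrate the covering inequality over a block of length [L]: by stationarity the left side has
    mean [L * lam * P], the right side at most [(L + N) * eps], and [L] tends to infinity.
    Monotonicity in older letters lets a window be evaluated inside the longer word. *)
Lemma maximal_ineq (y : seq S -> R) (lam eps : R) (N : nat) :
  (forall w, 0 <= y w) -> (forall w w', y w <= y (w ++ w')) ->
  0 <= lam -> (forall l, Ew l.+1 y <= eps) ->
  lam * Ew N (fun w => (exceeds y lam N w)%:R) <= eps.
Proof.
move=> y0 ymono lam0 Hy; set P := Ew N _.
have eps0 : 0 <= eps.
  by apply: le_trans (Hy 0%N); rewrite -(Ew_cst 1 0); apply: Ew_le.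
have key L : lam * (L%:R * P) <= (L + N)%:R * eps.
  pose r (w : seq S) l := y (drop (L + N - l.+1) w).
  (* [drop] keeps the times up to [a + N], [take] then those from [a] on. *)
  pose B (w : seq S) a := (a < L)%N && exceeds y lam N (take N.+1 (drop (L - a) w)).
  have cov w : size w = (L + N).+1 ->
      lam * \sum_(0 <= i < L) (B w i)%:R <= \sum_(0 <= l < L + N) r w l.
    move=> sw; apply: covering_sum => // [l|a]; first exact: y0.
    move=> /andP[aL /existsP[n Hn]]; exists n; first exact: ltn_ord.
    apply: le_trans (ltW Hn) _; rewrite !big_nat; apply: ler_sum => l /andP[_ ln].
    rewrite /r; have lN : (l < N)%N by exact: leq_trans ln (ltn_ord n).
    have -> : drop (L + N - (a + l).+1) w = drop (N - l.+1) (drop (L - a) w).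
      by rewrite drop_drop; congr drop; lia.
    rewrite -{2}(cat_take_drop N.+1 (drop (L - a) w)) drop_cat.
    by rewrite size_takel ?size_drop ?sw; [rewrite ifT; [exact: ymono|lia]|lia].
  have := Ew_le cov.
  rewrite EwZ !Ew_sum => /le_trans Hle.
  have -> : L%:R * P = \sum_(0 <= i < L) Ew (L + N) (fun w => (B w i)%:R).
    rewrite big_nat (eq_bigr (fun=> P)).
      by rewrite -big_nat sumr_const_nat subn0 mulr_natl.
    move=> a /andP[_ aL]; rewrite /P -[RHS](Ew_take N a) -[RHS](Ew_drop (L - a)).
    have -> : (L - a + (N + a) = L + N)%N by lia.
    by apply: eq_Ew => w _; rewrite /B aL.
  apply: Hle; apply: le_trans (_ : \sum_(0 <= l < L + N) eps <= _).
    rewrite !big_nat; apply: ler_sum => l /andP[_ lL].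
    apply: le_trans (Hy l); rewrite -[leRHS](Ew_drop (L + N - l.+1)) subnK //.
  by rewrite sumr_const_nat subn0 mulr_natl.
rewrite leNgt; apply/negP => lt_eps.
(* Otherwise [key] would give [L * (lam * P - eps) <= N * eps] for every [L]. *)
have d0 : 0 < lam * P - eps by rewrite subr_gt0.
have := archi_boundP (x := N%:R * eps / (lam * P - eps)).
rewrite divr_ge0 ?mulr_ge0 ?(ltW d0) // => /(_ isT); set L := Num.bound _.
rewrite ltr_pdivrMr // => HL.
by have := key L; rewrite natrD; move: HL; nra.
Qed.

(** Sum of the prediction errors of [F] along the word; the oldest letter has no prediction and
    contributes zero. *)
Fixpoint martingale (F : seq S -> R) (w : seq S) : R :=
  if w is _ :: w' then
    if w' is [::] then 0 else F w - predict F w' + martingale F w'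
  else 0.

Section Moments.
Variables (F : seq S -> R) (M : R).
Hypothesis F_bounded : forall w, `|F w| <= M.

Let M_ge0 : 0 <= M := le_trans (normr_ge0 (F [::])) (F_bounded [::]).

Let D i w := F (i :: w) - predict F w.

Let D_mean w : \sum_i p i (head s0 w) * D i w = 0.
Proof.
under eq_bigr do rewrite mulrBr.
by rewrite sumrB -mulr_suml p_sum1 mul1r subrr.
Qed.

Lemma predict_bounded w : `|predict F w| <= M.
Proof.
apply: le_trans (ler_norm_sum _ _ _) _.
rewrite -[leRHS](predict_cst M w); apply: ler_sum => i _.
by rewrite normrM (ger0_norm (p_ge0 _ _)) ler_wpM2l.
Qed.

Let D_bounded i w : `|D i w| <= 2 * M.
Proof.
apply: le_trans (ler_normB _ _) _; rewrite mulr_natl mulr2n.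
by rewrite lerD ?predict_bounded.
Qed.

(** The increments have conditional mean zero, so cross terms vanish and each step adds at most
    [(2 * M) ^+ 2]. *)
Lemma Ew_martingale_sqr n :
  Ew n (fun w => martingale F w ^+ 2) <= (2 * M) ^+ 2 * n%:R.
Proof.
elim: n => [|n IH].
  rewrite mulr0 -(Ew_cst 0 0); apply: Ew_le => -[//|i [|//]] _ /=.
  by rewrite expr0n.
rewrite EwS -[n.+1%:R]natr1 mulrDr mulr1.
apply: le_trans (_ : Ew n (fun w => martingale F w ^+ 2 + (2 * M) ^+ 2) <= _); last first.
  by rewrite EwD Ew_cst lerD.
apply: Ew_le => -[//|j w] _; set v := j :: w; set s := martingale F v.
have e i : martingale F (i :: v) = D i v + s by [].
rewrite /predict.
have -> : \sum_i p i (head s0 v) * martingale F (i :: v) ^+ 2 =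
    \sum_i p i (head s0 v) * (D i v ^+ 2 + s ^+ 2)
    + 2 * s * \sum_i p i (head s0 v) * D i v.
  by rewrite mulr_sumr -big_split; apply: eq_bigr => i _; rewrite e /=; ring.
rewrite D_mean mulr0 addr0 -[leRHS](predict_cst _ v); apply: ler_sum => i _.
apply: ler_wpM2l => //; rewrite addrC lerD2l -real_normK ?num_real //.
by rewrite lerXn2r ?nnegrE ?mulr_ge0.
Qed.

(** With increment [x] and past sum [s], the term linear in [x] has mean zero and the rest is at
    most [s^4 + 8 K^2 s^2 + 3 K^4]. The factor 4 closes the induction:
    [4 n^2 + 8 n + 3 <= 4 (n + 1)^2]. *)
Lemma Ew_martingale_pow4 n :
  Ew n (fun w => martingale F w ^+ 4) <= 4 * (2 * M) ^+ 4 * n%:R ^+ 2.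
Proof.
set K := 2 * M; elim: n => [|n IH].
  rewrite expr0n mulr0 -(Ew_cst 0 0); apply: Ew_le => -[//|i [|//]] _ /=.
  by rewrite expr0n.
rewrite EwS.
apply: le_trans (_ : Ew n (fun w => martingale F w ^+ 4 +
    (8 * K ^+ 2 * martingale F w ^+ 2 + 3 * K ^+ 4)) <= _); last first.
  rewrite !EwD EwZ Ew_cst -[n.+1%:R]natr1.
  have := Ew_martingale_sqr n; rewrite -/K; set a := Ew n _; set b := Ew n _ => Ha.
  have K2 : 0 <= K ^+ 2 by exact: sqr_ge0.
  have := ler_wpM2l K2 Ha; have : 0 <= K ^+ 4 by exact: exprn_even_ge0.
  have : 0 <= n%:R :> R by [].
  by move: IH; rewrite -/b; nra.
apply: Ew_le => -[//|j w] _; set v := j :: w; set s := martingale F v.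
have e i : martingale F (i :: v) = D i v + s by [].
rewrite /predict.
have -> : \sum_i p i (head s0 v) * martingale F (i :: v) ^+ 4 =
    \sum_i p i (head s0 v) *
      (D i v ^+ 4 + 4 * D i v ^+ 3 * s + 6 * D i v ^+ 2 * s ^+ 2 + s ^+ 4)
    + 4 * s ^+ 3 * \sum_i p i (head s0 v) * D i v.
  by rewrite mulr_sumr -big_split; apply: eq_bigr => i _; rewrite e /=; ring.
rewrite D_mean mulr0 addr0 -[leRHS](predict_cst _ v); apply: ler_sum => i _.
apply: ler_wpM2l => //; set x := D i v.
have x2 : x ^+ 2 <= K ^+ 2.
  rewrite -real_normK ?num_real // lerXn2r ?nnegrE ?mulr_ge0 //.
  exact: D_bounded.
have x4 : x ^+ 4 <= K ^+ 4.
  by rewrite -[4%N]/((2 * 2)%N) !exprM lerXn2r ?nnegrE ?sqr_ge0.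
have xs : x ^+ 2 * s ^+ 2 <= K ^+ 2 * s ^+ 2 by rewrite ler_wpM2r ?sqr_ge0.
(* This square absorbs the cubic term: [2 x^3 s <= x^4 + x^2 s^2]. *)
have : 0 <= (x ^+ 2 - x * s) ^+ 2 by exact: sqr_ge0.
have -> : (x ^+ 2 - x * s) ^+ 2 = x ^+ 4 - 2 * x ^+ 3 * s + x ^+ 2 * s ^+ 2 by ring.
lra.
Qed.

Lemma Ew_martingale_tail n (lam : R) : 0 < lam -> (0 < n)%N ->
  Ew n (fun w => (lam * n%:R < `|martingale F w|)%R%:R) <=
    4 * (2 * M) ^+ 4 / lam ^+ 4 * n%:R ^- 2.
Proof.
move=> lam0 n0; have n0' : 0 < n%:R :> R by rewrite ltr0n.
have l4 : 0 < lam ^+ 4 by rewrite exprn_gt0.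
suff : (lam ^+ 4 * n%:R ^+ 4) * Ew n (fun w => (lam * n%:R < `|martingale F w|)%R%:R)
    <= 4 * (2 * M) ^+ 4 * n%:R ^+ 2.
  rewrite mulrC -ler_pdivlMr ?mulr_gt0 ?exprn_gt0 // => /le_trans; apply.
  rewrite le_eqVlt; apply/orP; left; apply/eqP; field.
  by rewrite !gt_eqF.
rewrite -EwZ; apply: le_trans (Ew_martingale_pow4 n); apply: Ew_le => w _.
have [lt|_] := boolP (lam * n%:R < `|martingale F w|)%R; last by rewrite mulr0 exprn_even_ge0.
rewrite mulr1 -exprMn -[leRHS]ger0_norm ?exprn_even_ge0 // normrX.
by rewrite lerXn2r ?nnegrE ?(ltW lt) // mulr_ge0 // ltW.
Qed.

End Moments.

End MarkovWords.

(** * The projective line, rank one matrices and measurability of the action *)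

Section Projective.
Variable R : realType.
Implicit Types (v w : 'cV[R]_2) (M : 'M[R]_2) (x : P1 R).

Lemma ord2P (P : 'I_2 -> Prop) : P 0 -> P 1 -> forall i, P i.
Proof.
move=> P0 P1 i; case: (unliftP 0 i) => [j ->|-> //].
by rewrite (ord1 j) (_ : lift _ _ = 1) //; apply/val_inj.
Qed.

Lemma col2P v w : v 0 0 = w 0 0 -> v 1 0 = w 1 0 -> v = w.
Proof. by move=> e0 e1; apply/matrixP; elim/ord2P => j; rewrite ord1. Qed.

Lemma det2E M : \det M = M 0 0 * M 1 1 - M 0 1 * M 1 0.
Proof.
rewrite (expand_det_row _ 0) !big_ord_recl big_ord0 addr0 /cofactor !det_mx11.
rewrite !mxE /= (_ : lift 0 0 = 1); last exact/val_inj.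
rewrite (_ : lift 1 0 = 0); last exact/val_inj.
by rewrite !expr0 expr1 mul1r mulN1r mulrN.
Qed.

Lemma vnorm_ge0 v : 0 <= vnorm v.
Proof. exact: sqrtr_ge0. Qed.

Lemma vnormZ a v : vnorm (a *: v) = `|a| * vnorm v.
Proof.
rewrite /vnorm !mxE !exprMn -mulrDr sqrtrM ?sqr_ge0 //.
by rewrite sqrtr_sqr.
Qed.

Lemma vnorm_eq0 v : (vnorm v == 0) = (v == 0).
Proof.
apply/eqP/eqP => [|->]; last by rewrite /vnorm !mxE expr0n addr0 sqrtr0.
move/eqP; rewrite sqrtr_eq0 => le0.
have := sqr_ge0 (v 0 0); have := sqr_ge0 (v 1 0) => h1 h0.
by apply: col2P; rewrite mxE; apply/eqP; rewrite -sqrf_eq0 eq_le; apply/andP; split=> //; lra.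
Qed.

Lemma vnorm_p1v x : vnorm (p1v x) = 1.
Proof. by case: x => v /= /andP[/eqP]. Qed.

Lemma canonN v : vnorm v = 1 -> ~~ Defs.canon v -> Defs.canon (- v).
Proof.
move=> v1; rewrite /Defs.canon -scaleN1r vnormZ normrN1 mul1r v1 eqxx /= !mxE !mulN1r.
rewrite !oppr_gt0 oppr_eq0 negb_or negb_and -leNgt => /andP[le1 H].
move: le1; rewrite le_eqVlt => /orP[/eqP e1|->//].
move: H; rewrite e1 eqxx ltxx /= -leNgt le_eqVlt => /orP[/eqP e0|->//].
by move: v1; rewrite /vnorm e0 e1 expr0n addr0 sqrtr0 => /eqP; rewrite eq_sym oner_eq0.
Qed.

Lemma p1v_lineof v : v != 0 ->
  p1v (lineof v) = if Defs.canon ((vnorm v)^-1 *: v) then (vnorm v)^-1 *: v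
                   else - ((vnorm v)^-1 *: v).
Proof.
move=> v0; set u := _ *: v.
have u1 : vnorm u = 1.
  by rewrite vnormZ ger0_norm ?invr_ge0 ?vnorm_ge0 // mulVf // vnorm_eq0.
rewrite /lineof -/u; apply: (@insubdK _ _ (P1type R)).
by case: ifPn => // /(canonN u1).
Qed.

Lemma lineofE v : v != 0 ->
  exists2 t : R, v = t *: p1v (lineof v) & `|t| = vnorm v.
Proof.
move=> v0; rewrite (p1v_lineof v0); have n0 : vnorm v != 0 by rewrite vnorm_eq0.
case: ifP => _; [exists (vnorm v)|exists (- vnorm v)].
- by rewrite scalerA divff // scale1r.
- by rewrite ger0_norm // vnorm_ge0.
- by rewrite scaleNr scalerN opprK scalerA divff // scale1r.
- by rewrite normrN ger0_norm // vnorm_ge0.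
Qed.

Lemma rangevec_neq0 M : M != 0 -> rangevec M != 0.
Proof.
rewrite /rangevec; case: ifPn => // /negPn/eqP c0; apply: contra => /eqP c1.
apply/eqP/matrixP => i j; rewrite mxE; move: j; apply: ord2P.
  by have /matrixP/(_ i 0) := c0; rewrite !mxE.
by have /matrixP/(_ i 0) := c1; rewrite !mxE.
Qed.

(** The determinant vanishes, so the columns are proportional. The left factor is taken at the very
    point to which [pact M] sends every direction. *)
Lemma rank1_factor M : \rank M = 1%N ->
  exists2 l : 'rV[R]_2, l != 0 & M = p1v (lineof (rangevec M)) *m l.
Proof.
move=> rM; have M0 : M != 0 by apply/eqP => M0; move: rM; rewrite M0 mxrank0.
have : M \notin unitmx by rewrite -row_free_unit /row_free rM.
rewrite unitmxE unitfE negbK det2E subr_eq0 => /eqP detM.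
have [t Ht _] := lineofE (rangevec_neq0 M0); set x := p1v _ in Ht *.
suff [l Hl] : exists l : 'rV[R]_2, M = x *m l.
  by exists l => //; apply/eqP => l0; move: M0; rewrite Hl l0 mulmx0 eqxx.
suff [a [b [Ha Hb]]] : exists a b : R, col 0 M = a *: x /\ col 1 M = b *: x.
  exists (\row_j if j == 0 then a else b).
  apply/matrixP => i; apply: ord2P; rewrite !mxE big_ord1 !mxE /=.
    by have /matrixP/(_ i 0) := Ha; rewrite !mxE mulrC.
  by have /matrixP/(_ i 0) := Hb; rewrite !mxE mulrC.
move: Ht; rewrite /rangevec; case: ifPn => [c0 Ht|/negPn/eqP c0 Ht]; last first.
  by exists 0, t; rewrite c0 scale0r.
have [c Hc] : exists c : R, col 1 M = c *: col 0 M.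
  have [e|n0] := eqVneq (M 0 0) 0.
    have n1 : M 1 0 != 0.
      by apply: contra c0 => /eqP e'; apply/eqP/col2P; rewrite !mxE.
    exists (M 1 1 / M 1 0); apply: col2P; rewrite !mxE; last by rewrite divfK.
    move: detM; rewrite e mul0r mulr0 => /esym/eqP; rewrite mulf_eq0 (negbTE n1) orbF.
    by move/eqP.
  exists (M 0 1 / M 0 0); apply: col2P; rewrite !mxE; first by rewrite divfK.
  by apply: (mulfI n0); rewrite detM; field.
by exists t, (c * t); rewrite Hc Ht scalerA.
Qed.

Lemma p1v_neq0 x : p1v x != 0.
Proof. by rewrite -vnorm_eq0 vnorm_p1v oner_eq0. Qed.

(** A rank one matrix may kill [x]; then [t] is zero and the identity still holds at the point
    chosen by [pact]. *)
Lemma mulmx_pact M x : (\rank M == 1%N) || (M \in unitmx) ->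
  exists2 t : R, M *m p1v x = t *: p1v (pact M x) & `|t| = vnorm (M *m p1v x).
Proof.
move=> HM; rewrite /pact; case: eqP => [r1|r1].
  have [l _ Ml] := rank1_factor r1; set y := lineof _ in Ml *.
  have e : M *m p1v x = (l *m p1v x) 0 0 *: p1v y.
    by rewrite {1}Ml -mulmxA {1}[l *m _]mx11_scalar mul_mx_scalar.
  by exists ((l *m p1v x) 0 0); rewrite e // vnormZ vnorm_p1v mulr1.
have uM : M \in unitmx by move: HM => /orP[/eqP|].
apply: lineofE; apply: contra (p1v_neq0 x) => /eqP e; apply/eqP.
by rewrite -(mulKmx uM (p1v x)) e mulmx0.
Qed.

Lemma cauchy_schwarz2 (a b c e : R) :
  `|a * c + b * e| <= Num.sqrt (a ^+ 2 + b ^+ 2) * Num.sqrt (c ^+ 2 + e ^+ 2).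
Proof.
rewrite -sqrtrM ?addr_ge0 ?sqr_ge0 // -sqrtr_sqr ler_wsqrtr //.
rewrite -subr_ge0; have : 0 <= (a * e - b * c) ^+ 2 by exact: sqr_ge0.
by congr (0 <= _); ring.
Qed.

(** Cauchy-Schwarz gives the upper bound, and the normalised transpose of [l] attains it. *)
Lemma opnorm_rank1 (t : R) x (l : 'rV[R]_2) : l != 0 ->
  opnorm (t *: (p1v x *m l)) = `|t| * vnorm l^T.
Proof.
move=> l0; have n0 : vnorm l^T != 0 by rewrite vnorm_eq0 trmx_eq0.
have lv v : (l *m v) 0 0 = l^T 0 0 * v 0 0 + l^T 1 0 * v 1 0.
  rewrite !mxE !big_ord_recl big_ord0 addr0.
  by rewrite (_ : lift _ _ = 1) //; exact/val_inj.
have E v : vnorm ((t *: (p1v x *m l)) *m v) = `|t| * `|(l *m v) 0 0|.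
  rewrite -scalemxAl -mulmxA {1}[l *m v]mx11_scalar mul_mx_scalar !vnormZ.
  by rewrite vnorm_p1v mulr1.
rewrite /opnorm; set A := (X in sup X).
have Aub : ubound A (`|t| * vnorm l^T).
  move=> _ [v /= v1 <-]; rewrite E ler_wpM2l // lv.
  by apply: le_trans (cauchy_schwarz2 _ _ _ _) _; rewrite -[X in _ * X]/(vnorm v) v1 mulr1.
have Amem : A (`|t| * vnorm l^T).
  exists ((vnorm l^T)^-1 *: l^T) => /=.
    by rewrite vnormZ ger0_norm ?invr_ge0 ?vnorm_ge0 // mulVf.
  rewrite E -scalemxAr mxE lv -!expr2 normrM ger0_norm ?invr_ge0 ?vnorm_ge0 //.
  rewrite ger0_norm ?addr_ge0 ?sqr_ge0 //; congr (_ * _).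
  rewrite -[X in _ * X](@sqr_sqrtr _ (_ + _)) ?addr_ge0 ?sqr_ge0 //.
  by rewrite -/(vnorm l^T) expr2 mulKf.
apply/eqP; rewrite eq_le; apply/andP; split.
  by apply: ge_sup => //; exists (`|t| * vnorm l^T).
by apply: ub_le_sup => //; exists (`|t| * vnorm l^T).
Qed.

Lemma P1emb_measurable : measurable_fun setT (@P1emb R : P1 R -> R * R).
Proof. by move=> _ B mB; rewrite setTI; exists B => //; rewrite setTI. Qed.

Lemma measurable_to_P1 d (T : measurableType d) (f : T -> P1 R) :
  measurable_fun setT (fun t => p1v (f t) 0 0) ->
  measurable_fun setT (fun t => p1v (f t) 1 0) -> measurable_fun setT f.
Proof.
move=> m0 m1 _ _ [B mB <-]; rewrite setTI.
have : measurable_fun setT ((@P1emb R : P1 R -> R * R) \o f).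
  by apply: measurable_fun_pair.
by move=> /(_ measurableT B mB); rewrite !setTI.
Qed.

Lemma measurable_p1v i : measurable_fun setT (fun x : P1 R => p1v x i 0).
Proof.
move: i; apply: ord2P.
  exact: (measurableT_comp measurable_fst P1emb_measurable).
exact: (measurableT_comp measurable_snd P1emb_measurable).
Qed.

Lemma measurable_mulmx M i :
  measurable_fun setT (fun x : P1 R => (M *m p1v x) i 0).
Proof.
under eq_fun do rewrite mxE; apply: measurable_sum => j.
by apply: measurable_funM => //; exact: measurable_p1v.
Qed.

Lemma measurable_vnorm_mulmx M :
  measurable_fun setT (fun x : P1 R => vnorm (M *m p1v x)).
Proof.
have ms : measurable_fun setT (@Num.sqrt R).
  by apply: continuous_measurable_fun; exact: sqrt_continuous.
apply: (measurableT_comp ms).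
by apply: measurable_funD; apply: measurable_funX; exact: measurable_mulmx.
Qed.

(** In the rank one case the map is constant. In the invertible case the image is normalised, then
    its sign is fixed by a measurable test on the coordinates. *)
Lemma measurable_pact M : (\rank M == 1%N) || (M \in unitmx) ->
  measurable_fun setT (pact M).
Proof.
move=> HM; case: (boolP (\rank M == 1%N)) HM => [r1 _|r1 /= uM].
  by rewrite /pact r1.
pose u x := (vnorm (M *m p1v x))^-1 *: (M *m p1v x).
have mu i : measurable_fun setT (fun x : P1 R => u x i 0).
  have -> : (fun x => u x i 0) =
      (fun x => vnorm (M *m p1v x) `^ (-1) * (M *m p1v x) i 0).
    by apply/funext => x; rewrite mxE powR_inv1 // vnorm_ge0.
  apply: measurable_funM; last exact: measurable_mulmx.
  exact: (measurableT_comp (measurable_powR (-1)) (measurable_vnorm_mulmx M)).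
have mx0 x : M *m p1v x != 0.
  apply: contra (p1v_neq0 x) => /eqP e; apply/eqP.
  by rewrite -(mulKmx uM (p1v x)) e mulmx0.
have pE x i : p1v (pact M x) i 0 =
    if (0 < u x 1 0) || ((u x 1 0 == 0) && (0 < u x 0 0)) then u x i 0 else - u x i 0.
  rewrite /pact (negbTE r1) p1v_lineof // -/(u x) /Defs.canon.
  rewrite vnormZ ger0_norm ?invr_ge0 ?vnorm_ge0 // mulVf ?vnorm_eq0 // eqxx /=.
  by case: ifP => // _; rewrite mxE.
have mpi i : measurable_fun setT (fun x => p1v (pact M x) i 0).
  rewrite (_ : (fun _ => _) =
    (fun x => if (0 < u x 1 0) || ((u x 1 0 == 0) && (0 < u x 0 0))
              then u x i 0 else - u x i 0)); last by apply/funext.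
  apply: measurable_fun_ifT => //; last exact: measurable_funN.
  apply: measurable_or; first exact: measurable_fun_ltr.
  apply: measurable_and; first exact: measurable_fun_eqr.
  exact: measurable_fun_ltr.
by apply: measurable_to_P1.
Qed.

End Projective.

(** * Enumeration of words and their probabilities *)

Section Words.
Variables (R : realType) (S : finType) (s0 : S).
Variables (p : S -> S -> R) (q : S -> R).

Fixpoint words (n : nat) : seq (seq S) :=
  if n is n'.+1 then [seq i :: w | w <- words n', i <- enum S]
  else [seq [:: j] | j <- enum S].

Fixpoint weight (w : seq S) : R :=
  if w is i :: w' then
    if w' is [::] then q i else p i (head s0 w') * weight w'
  else 0.

Lemma size_words n w : w \in words n -> size w = n.+1.
Proof.
elim: n w => [|n IH] w /=; first by case/mapP => j _ ->.
by case/allpairsP => -[v i] /= [/IH <- _ ->].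
Qed.

Lemma mem_words n w : size w = n.+1 -> w \in words n.
Proof.
elim: n w => [|n IH] [|i w] //= [sw].
  by case: w sw => // _; apply/mapP; exists i; rewrite ?mem_enum.
by apply/allpairsP; exists (w, i) => /=; rewrite IH ?mem_enum.
Qed.

Lemma uniq_words n : uniq (words n).
Proof.
elim: n => [|n IH] /=; first by rewrite map_inj_uniq ?enum_uniq // => i j [].
by apply: allpairs_uniq; rewrite ?enum_uniq // => -[v i] [w j] _ _ /= [-> ->].
Qed.

Lemma Ew_words n F : Ew s0 p q n F = \sum_(w <- words n) weight w * F w.
Proof.
elim: n F => [|n IH] F /=; first by rewrite big_map big_enum.
rewrite IH big_allpairs_dep /= !big_seq; apply: eq_bigr => w /size_words sw.
rewrite big_enum mulr_sumr; apply: eq_bigr => i _ /=.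
by case: w sw => //= j w _; rewrite mulrCA mulrA.
Qed.

End Words.

(** * The Markov chain: transfer from words to almost sure statements *)

Section Chain.
Variables (R : realType) (k : nat).
Variables (p : alph k -> alph k -> R) (q : alph k -> R).
Hypothesis p_ge0 : forall i j, 0 <= p i j.
Hypothesis p_sum1 : forall j, \sum_i p i j = 1.
Hypothesis q_ge0 : forall j, 0 <= q j.
Hypothesis q_sum1 : \sum_j q j = 1.
Hypothesis q_stat : forall i, \sum_j p i j * q j = q i.
Variables (d : measure_display) (Omega : measurableType d).
Variables (Pr : probability Omega R) (X : nat -> Omega -> alph k).
Hypothesis X_chain : markov_chain p Pr q X.

Local Notation s0 := (ord0 : alph k).
Local Notation E := (Ew s0 p q).

Fixpoint past (n : nat) (o : Omega) : seq (alph k) :=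
  if n is n'.+1 then X n o :: past n' o else [:: X 0 o].

Lemma size_past n o : size (past n o) = n.+1.
Proof. by elim: n => //= n ->. Qed.

Lemma past_drop n m o : past n o = drop m (past (m + n) o).
Proof. by elim: m => [|m IH]; rewrite ?drop0. Qed.

Lemma drop_past n m o : (n <= m)%N -> drop (m - n) (past m o) = past n o.
Proof. by move=> nm; rewrite [RHS](past_drop n (m - n)) subnK. Qed.

Lemma past_eqP n w o : size w = n.+1 ->
  past n o = w <-> forall l, (l <= n)%N -> X l o = nth s0 w (n - l).
Proof.
elim: n w => [|n IH] [|i w] //= [sw].
  case: w sw => // _; split; first by move=> [<-] l; rewrite leqn0 => /eqP ->.
  by move/(_ 0%N isT) => /= ->.
split.
  move=> [Xi /IH - /(_ sw) H] l; rewrite leq_eqVlt => /orP[/eqP ->|ln].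
    by rewrite subnn.
  by rewrite subSn // H.
move=> H; congr cons; first by have := H n.+1 (leqnn _); rewrite subnn.
apply/IH => // l ln; have := H l (leqW ln).
by rewrite subSn.
Qed.

Lemma measurable_X n j : measurable [set o | X n o = j].
Proof.
have := X_chain.1 n measurableT [set j] I; rewrite setTI.
by congr measurable.
Qed.

Lemma measurable_past n (w : seq (alph k)) : measurable [set o | past n o = w].
Proof.
elim: n w => [|n IH] [|i w] /=.
- by rewrite (_ : [set _ | _] = set0) //; apply/seteqP; split.
- have [->|w0] := eqVneq w [::].
    rewrite (_ : [set _ | _] = [set o | X 0 o = i]); first exact: measurable_X.
    by apply/seteqP; split => o /=; [case | move ->].
  rewrite (_ : [set _ | _] = set0) //; apply/seteqP; split => // o /= [_ e].
  by move: w0; rewrite -e.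
- by rewrite (_ : [set _ | _] = set0) //; apply/seteqP; split.
- rewrite (_ : [set _ | _] = [set o | X n.+1 o = i] `&` [set o | past n o = w]).
    by apply: measurableI; [exact: measurable_X|exact: IH].
  by apply/seteqP; split => o /= [-> <-].
Qed.

Lemma past_setE n (e : pred (seq (alph k))) :
  [set o | e (past n o)] =
  \bigcup_(w in [set` [seq w <- words _ n | e w]]) [set o | past n o = w].
Proof.
apply/seteqP; split => [x /= ex|x [w /=]].
  exists (past n x) => //=.
  by rewrite mem_filter ex mem_words // size_past.
by rewrite mem_filter => /andP[ew _] ->.
Qed.

Lemma measurable_past_set n (e : pred (seq (alph k))) :
  measurable [set o | e (past n o)].
Proof.
rewrite past_setE; apply: fin_bigcup_measurable; first exact: finite_seq.
by move=> w _; exact: measurable_past.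
Qed.

Lemma prob_past n w : size w = n.+1 ->
  Pr [set o | past n o = w] = (weight s0 p q w)%:E.
Proof.
move=> sw; rewrite (_ : [set _ | _] =
  [set o | forall l, (l <= n)%N -> X l o = nth s0 w (n - l)]); last first.
  by apply/seteqP; split => o /= /past_eqP; apply.
rewrite (X_chain.2 n (fun l => nth s0 w (n - l))) subn0; congr EFin.
elim: n w sw => [|n IH] [|i w] //= [sw].
  by case: w sw => // _; rewrite big_ord0 mulr1.
case: w sw => // j w sw; rewrite big_ord_recr /= subnn subSnn /=.
have /= <- := IH (j :: w) sw; rewrite [RHS]mulrC -[RHS]mulrA.
congr (_ * _); congr (_ * _); apply: eq_bigr => l _.
by rewrite subSS (subSn (ltnW (ltn_ord l))) -[(n - l)%N](subnSK (ltn_ord l)).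
Qed.

(** Bridge between the probability space and expectations over words: an event on the history is a
    finite disjoint union of cylinders. *)
Lemma prob_past_set n (e : pred (seq (alph k))) :
  Pr [set o | e (past n o)] = (E n (fun w => (e w)%:R))%:E.
Proof.
rewrite past_setE measure_fin_bigcup; first last.
- by move=> w _; exact: measurable_past.
- by move=> w1 w2 _ _ [x /= [<- <-]].
- exact: finite_seq.
rewrite -fsbig_seq ?filter_uniq ?uniq_words //.
rewrite big_filter Ew_words -sumEFin big_mkcond !big_seq.
apply: eq_bigr => w /size_words sw.
by case: (e w); rewrite ?mulr1 ?mulr0 //; apply: prob_past.
Qed.

Lemma martingale_past F n o :
  martingale s0 p F (past n o) =
  \sum_(0 <= l < n) (F (past l.+1 o) - predict s0 p F (past l o)).
Proof.
elim: n => [|n IH]; first by rewrite big_geq.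
rewrite big_nat_recr //= -IH [in RHS]addrC.
by case: (past n o) (size_past n o).
Qed.

Lemma sum_inv_sqr_le (n : nat) :
  \sum_(0 <= i < n) (i%:R ^- 2 : R) <= 2.
Proof.
(* The sharper bound telescopes; the term at [0] is zero because the inverse of zero is zero. *)
suff H : forall n, \sum_(0 <= i < n.+2) (i%:R ^- 2 : R) <= 2 - n.+1%:R^-1.
  case: n => [|[|n]]; first by rewrite big_geq.
    by rewrite big_nat1 expr0n /= invr0.
  by apply: le_trans (H n) _; rewrite gerBl invr_ge0.
move=> {}n; elim: n => [|n IH].
  by rewrite big_nat_recr //= big_nat1 expr0n /= invr0 expr1n invr1; lra.
rewrite big_nat_recr //=; apply: le_trans (lerD IH (lexx _)) _.
rewrite -[n.+2%:R]natr1; set x : R := n.+1%:R.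
have x0 : 0 < x by rewrite ltr0n.
rewrite -subr_ge0.
have -> : 2 - (x + 1)^-1 - (2 - x^-1 + (x + 1) ^- 2) = (x * (x + 1) ^+ 2)^-1.
  by field; rewrite !gt_eqF //; lra.
by rewrite invr_ge0 mulr_ge0 ?sqr_ge0 ?ltW.
Qed.

Lemma nneseries_inv_sqr_lty (C : R) : 0 <= C ->
  (\sum_(n <oo) (C * n%:R ^- 2)%:E < +oo)%E.
Proof.
move=> C0; apply: le_lt_trans (ltry (C * 2)); apply: lime_le.
  apply: is_cvg_nneseries => n _ _.
  by rewrite lee_fin mulr_ge0 // invr_ge0 exprn_even_ge0.
apply: nearW => n; rewrite sumEFin lee_fin -mulr_sumr.
by rewrite ler_wpM2l // sum_inv_sqr_le.
Qed.

Lemma martingale_lln F M : (forall w, `|F w| <= M) ->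
  {ae Pr, forall o, n%:R^-1 * martingale s0 p F (past n o) @[n --> \oo] --> (0 : R)}.
Proof.
move=> FM; pose mart n o := martingale s0 p F (past n o).
(* Countably many thresholds, so that the exceptional null sets can be united. *)
pose B r n := [set o | (r.+1%:R^-1 * n%:R < `|mart n o|)%R].
have mB r n : measurable (B r n).
  exact: (measurable_past_set n (fun w => r.+1%:R^-1 * n%:R < `|martingale s0 p F w|)%R).
have BC r : {ae Pr, forall o, ~ lim_sup_set (B r) o}.
  exists (lim_sup_set (B r)); split.
  - by apply: bigcapT_measurable => n; exact: bigcup_measurable.
  - apply: lim_sup_set_cvg0 => //.
    pose C : R := 4 * (2 * M) ^+ 4 / (r.+1%:R^-1) ^+ 4.
    have C0 : 0 <= C by apply: divr_ge0; [apply: mulr_ge0 => //|]; exact: exprn_even_ge0.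
    apply: le_lt_trans (nneseries_inv_sqr_lty C0); apply: lee_nneseries => //.
    move=> [|n] _.
      rewrite (_ : B r 0%N = set0) ?measure0.
        by rewrite lee_fin mulr_ge0 // invr_ge0 exprn_even_ge0.
      by apply/seteqP; split => // o /=; rewrite /B /= normr0 mulr0 ltxx.
    pose e w := r.+1%:R^-1 * n.+1%:R < `|martingale s0 p F w|.
    suff: ((E n.+1 (fun w => (e w)%:R))%:E <= (C * n.+1%:R ^- 2)%:E)%E.
      by rewrite -prob_past_set.
    by rewrite lee_fin; apply: Ew_martingale_tail; rewrite ?invr_gt0.
  - by move=> o /=; rewrite not_notE.
have := ae_foralln BC; apply: filterS => o Ho; apply/cvgrPdist_le => eps eps0.
have [r Hr] : exists r : nat, r.+1%:R^-1 < eps.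
  have := archi_boundP (ltW (_ : 0 < eps^-1)); rewrite invr_gt0 => /(_ eps0) Hb.
  exists (Num.bound eps^-1); rewrite invf_plt ?posrE //.
  by apply: lt_trans Hb _; rewrite ltr_nat.
have := Ho r; rewrite /lim_sup_set => /existsNP [N /not_implyP [_ HN]].
exists N.+1 => //= n /= ltNn; have n0 : 0 < n%:R :> R by rewrite ltr0n; lia.
rewrite sub0r normrN normrM gtr0_norm ?invr_gt0 // ler_pdivrMl //.
have : ~ B r n o by move=> Bn; apply: HN; exists n => //=; lia.
rewrite /B /= => /negP; rewrite -leNgt => /le_trans; apply.
by rewrite mulrC ler_wpM2l // ltW.
Qed.

(** The level of [y] and the window length grow together, so the sets [B N] increase and continuity
    from below carries the bound to their union. Outside it, one bound serves all levels and all
    lengths. *)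
Lemma maximal_prob (y : nat -> seq (alph k) -> R) (lam eps : R) :
  (forall n w, 0 <= y n w) -> (forall n w w', y n w <= y n (w ++ w')) ->
  (forall n w, y n w <= y n.+1 w) ->
  0 < lam -> (forall n l, E l.+1 (y n) <= eps) ->
  exists2 B : set Omega, measurable B & (Pr B <= (eps / lam)%:E)%E /\
    forall o, ~ B o -> forall L n,
      \sum_(0 <= l < n) y L (past l.+1 o) <= lam * n%:R.
Proof.
move=> y0 ymono yL lam0 Hy.
pose B N := [set o | exceeds (y N) lam N (past N o)].
have mB N : measurable (B N) by exact: measurable_past_set.
have Bsum N n o : (n <= N)%N -> ~ B N o ->
    \sum_(0 <= l < n) y N (past l.+1 o) <= lam * n%:R.
  case: n => [|n] nN; first by rewrite big_geq // mulr0.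
  move=> nB; rewrite leNgt; apply/negP => lt; apply: nB.
  apply/existsP; exists (Ordinal nN) => /=.
  rewrite [ltRHS](_ : _ = \sum_(0 <= l < n.+1) y N (past l.+1 o)) //.
  rewrite !big_nat; apply: eq_bigr => l /andP[_ ln]; congr (y N _).
  by rewrite drop_past //; lia.
have yle L N w : (L <= N)%N -> y L w <= y N w.
  move=> /subnK <-; elim: (N - L)%N => // m IH.
  by rewrite addSn; apply: le_trans IH _.
exists (\bigcup_N B N); first exact: bigcupT_measurable.
split.
  have ndB : nondecreasing_seq B.
    move=> N N' NN'; apply/subsetPset => o; rewrite /B /= => /existsP[n Hn].
    apply/existsP; exists (widen_ord NN' n); apply: lt_le_trans Hn _.
    rewrite !big_nat; apply: ler_sum => l /andP[_ ln].
    have lN : (l < N)%N by apply: leq_trans ln (ltn_ord n).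
    rewrite !drop_past // ?(leq_trans lN) //.
    exact: yle.
  have cv := nondecreasing_cvg_mu mB (bigcupT_measurable _ mB) ndB (mu := Pr).
  rewrite -(cvg_lim _ cv) //; apply: lime_le; first by apply/cvg_ex; eexists; exact: cv.
  apply: nearW => N /=; suff: ((E N (fun w => (exceeds (y N) lam N w)%:R))%:E <= (eps / lam)%:E)%E.
    by rewrite -prob_past_set.
  rewrite lee_fin ler_pdivlMr // mulrC.
  by apply: maximal_ineq => //; exact: ltW.
move=> o nBo L n; apply: le_trans (_ : \sum_(0 <= l < n) y (maxn L n) (past l.+1 o) <= _).
  by apply: ler_sum => l _; apply: yle; exact: leq_maxl.
by apply: Bsum; [exact: leq_maxr|move=> Bo; apply: nBo; exists (maxn L n)].
Qed.

End Chain.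

Lemma finite_pos_lower_bound (R : realFieldType) (T : finType) (f : T -> R) :
  (forall t, 0 < f t) -> exists2 c, 0 < c & forall t, c <= f t.
Proof.
move=> f0; have [t0|T0] := pickP (@predT T); last first.
  by exists 1 => // t; have := T0 t.
exists (f [arg min_(t < t0) f t]%O) => // t.
by case: Order.TotalTheory.arg_minP => // t1 _; apply.
Qed.

Lemma eq_of_near (R : realFieldType) (x y : R) :
  (forall e, 0 < e -> exists c, `|x - c| <= e /\ `|y - c| <= e) -> x = y.
Proof.
move=> H; apply/eqP; rewrite -subr_eq0 -normr_le0 leNgt; apply/negP => e0.
have [c [hx hy]] := H (`|x - y| / 3) ltac:(by rewrite divr_gt0).
have := ler_normB (x - c) (y - c); rewrite (_ : x - c - (y - c) = x - y); last by ring.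
by move: hx hy e0; set a := `|x - y|; lra.
Qed.

Section Operator.
Variables (R : realType) (k : nat) (A : alph k -> 'M[R]_2).
Variables (p : alph k -> alph k -> R) (q : alph k -> R).
Hypothesis A_rank : forall i, (\rank (A i) == 1%N) || (A i \in unitmx).
Hypothesis p_ge0 : forall i j, 0 <= p i j.
Hypothesis p_sum1 : forall j, \sum_i p i j = 1.
Hypothesis p_prim : primitive p.
Hypothesis q_ge0 : forall j, 0 <= q j.
Hypothesis q_sum1 : \sum_j q j = 1.
Hypothesis q_stat : forall i, \sum_j p i j * q j = q i.

Local Notation Z := (alph k * P1 R)%type.
Local Notation Q := (Qop p A).
Implicit Types (u : Z -> R) (z : Z) (eta : probability Z R).

Lemma QopE u z : Q u z = \sum_i u (i, pact (A i) z.2) * p i z.1.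
Proof. by []. Qed.

Lemma Qop_le u u' : (forall z, u z <= u' z) -> forall z, Q u z <= Q u' z.
Proof. by move=> le z; apply: ler_sum => i _; rewrite ler_wpM2r. Qed.

Lemma QopD u u' z : Q (fun z => u z + u' z) z = Q u z + Q u' z.
Proof. by rewrite -big_split; apply: eq_bigr => i _; rewrite mulrDl. Qed.

Lemma QopZ c u z : Q (fun z => c * u z) z = c * Q u z.
Proof. by rewrite mulr_sumr; apply: eq_bigr => i _; rewrite mulrA. Qed.

Lemma Qop_cst c z : Q (fun=> c) z = c.
Proof. by rewrite /Qop -mulr_sumr p_sum1 mulr1. Qed.

Lemma Qiter_le n u u' : (forall z, u z <= u' z) ->
  forall z, iter n Q u z <= iter n Q u' z.
Proof. by move=> le; elim: n => //= n IH; exact: Qop_le. Qed.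

Lemma Qiter_affine n c a u z :
  iter n Q (fun z => c + a * u z) z = c + a * iter n Q u z.
Proof.
elim: n z => //= n IH z.
rewrite (_ : iter n Q _ = fun z => c + a * iter n Q u z); last exact/funext.
by rewrite QopD Qop_cst QopZ.
Qed.

Lemma Qiter_bounds n u a b : (forall z, a <= u z <= b) ->
  forall z, a <= iter n Q u z <= b.
Proof.
move=> ab; elim: n => //= n IH z; apply/andP; split.
  by rewrite -[a](Qop_cst a z); apply: Qop_le => {}z; case/andP: (IH z).
by rewrite -[b](Qop_cst b z); apply: Qop_le => {}z; case/andP: (IH z).
Qed.

Lemma Qiter_bounded n u M : (forall z, `|u z| <= M) ->
  forall z, `|iter n Q u z| <= M.
Proof.
move=> uM z; rewrite ler_norml; apply: Qiter_bounds => {}z.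
by rewrite -ler_norml.
Qed.

Lemma measurable_alph d (T : measurableType d) (f : alph k -> T) :
  measurable_fun setT f.
Proof. by []. Qed.

Lemma measurable_section u i : measurable_fun setT u ->
  measurable_fun setT (fun z : Z => u (i, pact (A i) z.2)).
Proof.
move=> mu; apply: (measurableT_comp mu); apply: measurable_fun_pair => //.
exact: (measurableT_comp (measurable_pact (A_rank i)) measurable_snd).
Qed.

Lemma measurable_Qop u : measurable_fun setT u -> measurable_fun setT (Q u).
Proof.
move=> mu; apply: measurable_sum => i; apply: measurable_funM.
  exact: measurable_section.
exact: (measurableT_comp (measurable_alph (p i)) measurable_fst).
Qed.

Lemma measurable_Qiter n u :
  measurable_fun setT u -> measurable_fun setT (iter n Q u).
Proof. by move=> mu; elim: n => //= n; exact: measurable_Qop. Qed.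

Local Notation P := (\matrix_(i0 < k.+1, j0 < k.+1) p i0 j0 : 'M[R]_k.+1).

Lemma Qiter_fst n (f : alph k -> R) z :
  iter n Q (fun z => f z.1) z = \sum_(i : alph k) f i * (P ^+ n) i z.1.
Proof.
elim: n z => [|n IH] z /=.
  rewrite (bigD1 z.1) //= expr0 mxE eqxx mulr1 big1 ?addr0 // => i ne.
  by rewrite mxE (negbTE ne) mulr0.
transitivity (\sum_(j : alph k) \sum_(i : alph k) f i * (P ^+ n) i j * p j z.1).
  by apply: eq_bigr => j _; rewrite -mulr_suml; congr (_ * _); exact: IH.
rewrite exchange_big; apply: eq_bigr => i _ /=.
rewrite exprSr mxE mulr_sumr; apply: eq_bigr => j _.
by rewrite mxE mulrA.
Qed.

Section Doeblin.
Variable s : alph k.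
Hypothesis s_sing : \rank (A s) = 1%N.

Let zs : Z := (s, lineof (rangevec (A s))).

Lemma Qiter_lower n u z : (forall z, 0 <= u z) ->
  (P ^+ n.+1) s z.1 * u zs <= iter n.+1 Q u z.
Proof.
move=> u0; rewrite iterSr.
have le z' : (fun z : Z => p s z.1 * u zs) z' <= Q u z'.
  rewrite /Qop (bigD1 s) //= /pact s_sing eqxx mulrC lerDl.
  by apply: sumr_ge0 => i _; rewrite mulr_ge0.
apply: le_trans (Qiter_le n le z).
rewrite (Qiter_fst n (fun j => p s j * u zs)) exprS mxE mulr_suml.
rewrite le_eqVlt; apply/orP; left; apply/eqP; apply: eq_bigr => i _.
by rewrite mxE mulrAC.
Qed.

Lemma Pn_lower : exists n, exists2 c : R, 0 < c <= 1 & forall j, c <= (P ^+ n.+1) s j.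
Proof.
have [n Hn] := p_prim.
have [c c0 Hc] := finite_pos_lower_bound (fun l => Hn s l).
exists n, (Num.min c 1); first by rewrite lt_min c0 ltr01 ge_min lexx orbT.
move=> j; rewrite ge_min; apply/orP; left.
rewrite exprSr mxE -[c]mulr1 -(p_sum1 j) mulr_sumr; apply: ler_sum => l _.
by rewrite mxE ler_wpM2r.
Qed.

(* Doeblin: from every state the chain is at zs after m steps with
   probability at least c. *)
Lemma Qiter_contraction : exists m, exists2 c : R, 0 < c <= 1 &
  forall u a b, (forall z, a <= u z <= b) ->
    exists a' b', b' - a' = (1 - c) * (b - a) /\
      forall z, a' <= iter m Q u z <= b'.
Proof.
have [n [c c01 Hc]] := Pn_lower; have /andP[c0 c1] := c01.
exists n.+1, c => // u a b ab.
exists (a + c * (u zs - a)), (b - c * (b - u zs)); split; first by ring.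
have /andP[azs zsb] := ab zs.
have low v z : (forall z, 0 <= v z) -> c * v zs <= iter n.+1 Q v z.
  move=> v0; apply: le_trans (Qiter_lower n z v0).
  by rewrite ler_wpM2r.
move=> z; apply/andP; split.
  have := low (fun z => - a + 1 * u z) z; rewrite Qiter_affine => H.
  have /H : forall z', 0 <= - a + 1 * u z' by move=> z'; have /andP[] := ab z'; lra.
  by lra.
have := low (fun z => b + (-1) * u z) z; rewrite Qiter_affine => H.
have /H : forall z', 0 <= b + (-1) * u z' by move=> z'; have /andP[] := ab z'; lra.
by lra.
Qed.

Lemma Qiter_near_cst u M e : (forall z, `|u z| <= M) -> 0 < e ->
  exists N c, forall z, `|iter N Q u z - c| <= e.
Proof.
move=> uM e0; have [m [c /andP[c0 c1] Hc]] := Qiter_contraction.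
have M0 : 0 <= M by apply: le_trans (uM point).
have osc N : exists a b, b - a = (1 - c) ^+ N * (M + M) /\
    forall z, a <= iter (N * m) Q u z <= b.
  elim: N => [|N [a [b [ba Hab]]]].
    exists (- M), M; split; first by rewrite expr0 mul1r opprK.
    by move=> z; rewrite -ler_norml.
  have [a' [b' [ba' Hab']]] := Hc _ _ _ Hab.
  exists a', b'; split; first by rewrite ba' ba exprS mulrA.
  by move=> z; rewrite mulSn iterD.
have cv : (1 - c) ^+ N * (M + M) @[N --> \oo] --> (0 * (M + M) : R).
  apply: cvgMl; apply: cvg_expr; rewrite ger0_norm; lra.
rewrite mul0r in cv; have /cvgrPdist_le/(_ _ e0)[N _ /(_ N (leqnn N))] := cv.
rewrite /= sub0r normrN => HN; have [a [b [ba Hab]]] := osc N.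
exists (N * m)%N, a => z; have /andP[az zb] := Hab z.
rewrite ger0_norm ?subr_ge0 //; apply: le_trans HN; rewrite -ba.
by rewrite ger0_norm ?lerB // subr_ge0 (le_trans az).
Qed.

Definition bounded_measurable u :=
  measurable_fun setT u /\ exists M, forall z, `|u z| <= M.

Lemma bounded_measurable_Qiter n u :
  bounded_measurable u -> bounded_measurable (iter n Q u).
Proof.
move=> [mu [M uM]]; split; first exact: measurable_Qiter.
by exists M; exact: Qiter_bounded.
Qed.

Lemma bounded_measurable_fst (f : alph k -> R) :
  bounded_measurable (fun z => f z.1).
Proof.
split; first exact: (measurableT_comp (measurable_alph f) measurable_fst).
exists (\sum_(i : alph k) `|f i|) => z; rewrite (bigD1 z.1) //= lerDl.
exact: sumr_ge0.
Qed.

Lemma bounded_measurableM u u' :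
  bounded_measurable u -> bounded_measurable u' ->
  bounded_measurable (fun z => u z * u' z).
Proof.
move=> [mu [M uM]] [mu' [M' uM']]; split; first exact: measurable_funM.
by exists (M * M') => z; rewrite normrM ler_pM.
Qed.

Lemma bounded_measurableB u u' :
  bounded_measurable u -> bounded_measurable u' ->
  bounded_measurable (fun z => u z - u' z).
Proof.
move=> [mu [M uM]] [mu' [M' uM']]; split; first exact: measurable_funB.
by exists (M + M') => z; rewrite (le_trans (ler_normB _ _)) // lerD.
Qed.

Lemma bounded_integrable eta u :
  bounded_measurable u -> eta.-integrable setT (EFin \o u).
Proof.
move=> [mu [M uM]]; apply: measurable_bounded_integrable => //.
  exact: (le_lt_trans (probability_le1 eta measurableT) (ltry 1)).
exists M; split; first exact: num_real.
by move=> x Mx z _ /=; apply: le_trans (uM z) (ltW Mx).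
Qed.

Lemma EFin_mean eta u : bounded_measurable u ->
  (\int[eta]_z u z)%:E = (\int[eta]_z (u z)%:E)%E.
Proof.
move=> bu; rewrite /Rintegral fineK //; apply: integrable_fin_num => //.
exact: bounded_integrable.
Qed.

Lemma mean_cst eta c : \int[eta]_z (fun=> c) z = c.
Proof.
rewrite /= Rintegral_cst // [X in fine X](_ : _ = 1%E) ?mulr1 //.
exact: probability_setT.
Qed.

Lemma mean_le eta u u' : bounded_measurable u -> bounded_measurable u' ->
  (forall z, u z <= u' z) -> \int[eta]_z u z <= \int[eta]_z u' z.
Proof. by move=> bu bu' le; apply: le_Rintegral => //; exact: bounded_integrable. Qed.

Lemma bounded_measurable_cst c : bounded_measurable (fun=> c).
Proof. by split => //; exists `|c|. Qed.

Lemma mean_near eta u c e : bounded_measurable u ->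
  (forall z, `|u z - c| <= e) -> `|\int[eta]_z u z - c| <= e.
Proof.
move=> bu uc; have bc x := bounded_measurable_cst x.
rewrite ler_distl; apply/andP; split.
  rewrite -[c - e](mean_cst eta); apply: mean_le => // z.
  by move: (uc z); rewrite ler_distl => /andP[].
rewrite -[c + e](mean_cst eta); apply: mean_le => // z.
by move: (uc z); rewrite ler_distl => /andP[].
Qed.

Lemma stationary_mean eta u n : Q_stationary p A eta -> bounded_measurable u ->
  \int[eta]_z iter n Q u z = \int[eta]_z u z.
Proof.
move=> st bu; elim: n => //= n IH; rewrite -IH.
have bn := bounded_measurable_Qiter n bu.
apply: EFin_inj; rewrite !EFin_mean //; last exact: (bounded_measurable_Qiter n.+1).
by case: bn => mn Mn; exact: st.
Qed.

Lemma stationary_unique eta eta' : Q_stationary p A eta -> Q_stationary p A eta' ->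
  forall B, measurable B -> eta' B = eta B.
Proof.
move=> st st' B mB; pose u : Z -> R := \1_B.
have bu : bounded_measurable u.
  split; first exact: measurable_indic.
  by exists 1 => z; rewrite /u indicE ger0_norm // lern1 leq_b1.
suff e : \int[eta']_z u z = \int[eta]_z u z.
  have := EFin_mean eta bu; have := EFin_mean eta' bu.
  by rewrite !integral_indic // !setIT e => <- <-.
apply: eq_of_near => e e0; have [_ [M uM]] := bu.
have [N [c Hc]] := Qiter_near_cst uM e0; exists c.
rewrite -(stationary_mean N st bu) -(stationary_mean N st' bu).
have bN := bounded_measurable_Qiter N bu.
by split; exact: mean_near.
Qed.

Lemma qsum_Qiter (f : alph k -> R) n v :
  \sum_(j : alph k) q j * iter n Q (fun z => f z.1) (j, v) =
  \sum_(j : alph k) q j * f j.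
Proof.
have E m j w : iter m Q (fun z => f z.1) (j, w) = iter m Q (fun z => f z.1) (j, v).
  by rewrite !Qiter_fst.
elim: n => // n <-; under eq_bigr do rewrite iterS QopE mulr_sumr.
rewrite exchange_big; apply: eq_bigr => i _ /=.
rewrite -[in RHS]q_stat mulr_suml; apply: eq_bigr => j _.
by rewrite (E _ _ (pact (A i) v)) mulrC mulrAC mulrC mulrA mulrAC.
Qed.

Lemma stationary_fst eta (f : alph k -> R) : Q_stationary p A eta ->
  \int[eta]_z f z.1 = \sum_(j : alph k) q j * f j.
Proof.
move=> st; have bf := bounded_measurable_fst f.
apply: eq_of_near => e e0; have [_ [M fM]] := bf.
have [N [c Hc]] := Qiter_near_cst fM e0; exists c; split.
  rewrite -(stationary_mean N st bf).
  by apply: mean_near => //; exact: bounded_measurable_Qiter.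
rewrite -(qsum_Qiter f N point) -[c]mul1r -q_sum1 mulr_suml -sumrB.
apply: le_trans (ler_norm_sum _ _ _) _.
rewrite -[leRHS]mul1r -q_sum1 mulr_suml; apply: ler_sum => j _.
by rewrite -mulrBr normrM ger0_norm // ler_wpM2l.
Qed.

Fixpoint direction (w : seq (alph k)) : P1 R :=
  if w is x :: w' then pact (A x) (direction w') else point.

Local Notation s0 := (ord0 : alph k).

Definition state (w : seq (alph k)) : Z := (head s0 w, direction w).

Lemma predict_state u w :
  predict s0 p (fun w => u (state w)) w = Q u (state w).
Proof. by apply: eq_bigr => i _; rewrite mulrC. Qed.

Definition seen_singular (w : seq (alph k)) : bool :=
  has (fun x => \rank (A x) == 1%N) w.

Lemma direction_cat w w' : seen_singular w -> direction (w ++ w') = direction w.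
Proof.
elim: w => //= x w IH /orP[r1|/IH -> //].
by rewrite /pact r1.
Qed.

Let sg i := \rank (A i) == 1%N.
Let on_sing u z := (sg z.1)%:R * u z.
Let on_inv u z := (~~ sg z.1)%:R * u z.

Let Qop_on_sing u z : Q (on_sing u) z = Q (on_sing u) (z.1, point).
Proof.
apply: eq_bigr => i _; rewrite /on_sing /= /pact.
case e: (sg i); rewrite ?mul0r //.
by move: e; rewrite /sg => ->.
Qed.

Let bounded_measurable_on_inv u :
  bounded_measurable u -> bounded_measurable (Q (on_inv u)).
Proof.
move=> bu; apply: (bounded_measurable_Qiter 1); apply: bounded_measurableM => //.
exact: (bounded_measurable_fst (fun i => (~~ sg i)%:R)).
Qed.

Let stationary_split eta u : Q_stationary p A eta -> bounded_measurable u ->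
  \int[eta]_z u z =
    \sum_(j : alph k) q j * Q (on_sing u) (j, point) + \int[eta]_z Q (on_inv u) z.
Proof.
move=> st bu; rewrite -(stationary_mean 1 st bu) /=.
have bs : bounded_measurable (Q (on_sing u)).
  apply: (bounded_measurable_Qiter 1); apply: bounded_measurableM => //.
  exact: (bounded_measurable_fst (fun i => (sg i)%:R)).
rewrite -(stationary_fst (fun j => Q (on_sing u) (j, point)) st).
under [X in _ = X + _]eq_Rintegral do rewrite -Qop_on_sing.
rewrite -RintegralD; [|exact: measurableT|exact: bounded_integrable|]; last first.
  by apply: bounded_integrable; exact: bounded_measurable_on_inv.
apply: eq_Rintegral => z _; rewrite -QopD; apply: eq_bigr => i _; congr (_ * _).
by rewrite /on_sing /on_inv; case: (sg _); rewrite /= mul1r mul0r ?addr0 ?add0r.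
Qed.

(* The law of the chain started in the past dominates its restriction to the
   event that the direction no longer depends on the initial one. *)
Lemma Ew_seen_singular_le eta u n : Q_stationary p A eta ->
  bounded_measurable u -> (forall z, 0 <= u z) ->
  Ew s0 p q n (fun w => (seen_singular w)%:R * u (state w)) <= \int[eta]_z u z.
Proof.
move=> st; elim: n u => [|n IH] u bu u0.
all: have bi := bounded_measurable_on_inv bu.
all: have Qi0 z : 0 <= Q (on_inv u) z by apply: sumr_ge0 => i _; rewrite !mulr_ge0.
all: rewrite (stationary_split st bu).
  apply: ler_wpDr.
    by rewrite -(mean_cst eta 0); apply: mean_le => //; exact: bounded_measurable_cst.
  pose f j := (sg j)%:R * u (j, direction [:: j]).
  rewrite [leLHS](_ : _ = \sum_(j : alph k) q j * f j); last first.
    by apply: eq_bigr => j _; rewrite /= orbF.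
  rewrite -(qsum_Qiter f 1 point) le_eqVlt; apply/orP; left; apply/eqP.
  by apply: eq_bigr => j _; congr (_ * _); apply: eq_bigr => i _; congr (_ * _).
pose f j := Q (on_sing u) (j, point).
rewrite EwS (@eq_Ew _ _ s0 p q p_ge0 q_ge0 n _
  (fun w => f (head s0 w) + (seen_singular w)%:R * Q (on_inv u) (state w))); last first.
  move=> w _; rewrite /f -(Qop_on_sing u (state w)) /predict mulr_sumr -big_split /=.
  apply: eq_bigr => i _; rewrite /on_sing /on_inv /state /= -/(sg i).
  by case: (sg i); case: (seen_singular w); rewrite /= !(mul1r, mul0r, mulr0, addr0, add0r) // mulrC.
rewrite EwD // (Ew_head s0 q_stat n f) lerD2l.
exact: IH.
Qed.

End Doeblin.


End Operator.

Lemma cvg_EFin_seq (R : realType) (f : nat -> R) (a : R) :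
  f n @[n --> \oo] --> a -> (f n)%:E @[n --> \oo] --> a%:E.
Proof. by move=> fa; apply: cvg_EFin => //; exact: nearW. Qed.

Section Existence.
Variables (R : realType) (k : nat) (A : alph k -> 'M[R]_2).
Variables (p : alph k -> alph k -> R) (q : alph k -> R).
Hypothesis A_rank : forall i, (\rank (A i) == 1%N) || (A i \in unitmx).
Hypothesis p_ge0 : forall i j, 0 <= p i j.
Hypothesis p_sum1 : forall j, \sum_i p i j = 1.
Hypothesis p_prim : primitive p.
Hypothesis q_ge0 : forall j, 0 <= q j.
Hypothesis q_sum1 : \sum_j q j = 1.
Hypothesis q_stat : forall i, \sum_j p i j * q j = q i.
Variable s : alph k.
Hypothesis s_sing : \rank (A s) = 1%N.

Local Notation Z := (alph k * P1 R)%type.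
Local Notation Q := (Qop p A).
Implicit Types (u : Z -> R) (z : Z).

Let sing i := \rank (A i) == 1%N.

Definition killed u z : R := Q (fun z => (~~ sing z.1)%:R * u z) z.

Let base (j : alph k) : Z := (j, lineof (rangevec (A j))).

Definition excursion n u : R :=
  \sum_(j : alph k) (sing j)%:R * q j * iter n killed u (base j).

Lemma killedE u z :
  killed u z = \sum_(i : alph k) (~~ sing i)%:R * p i z.1 * u (i, pact (A i) z.2).
Proof. by apply: eq_bigr => i _ /=; rewrite mulrAC. Qed.

Lemma killed_le u u' : (forall z, u z <= u' z) -> forall z, killed u z <= killed u' z.
Proof. by move=> le; apply: Qop_le => // z; rewrite ler_wpM2l. Qed.

Lemma killed_iter_le n u u' : (forall z, u z <= u' z) ->
  forall z, iter n killed u z <= iter n killed u' z.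
Proof. by move=> le; elim: n => //= n IH; exact: killed_le. Qed.

Lemma killedD u u' z : killed (fun z => u z + u' z) z = killed u z + killed u' z.
Proof. by rewrite -QopD; apply: eq_bigr => i _; rewrite mulrDr. Qed.

Lemma killed_iterD n u u' z : iter n killed (fun z => u z + u' z) z =
  iter n killed u z + iter n killed u' z.
Proof.
elim: n z => //= n IH z; rewrite -killedD; congr (killed _ z); exact/funext.
Qed.

Lemma killedZ c u z : killed (fun z => c * u z) z = c * killed u z.
Proof. by rewrite -QopZ; apply: eq_bigr => i _; rewrite mulrCA. Qed.

Lemma killed_iterZ n c u z :
  iter n killed (fun z => c * u z) z = c * iter n killed u z.
Proof.
elim: n z => //= n IH z; rewrite -killedZ; congr (killed _ z); exact/funext.
Qed.

Lemma killed_iter_ge0 n u z : (forall z, 0 <= u z) -> 0 <= iter n killed u z.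
Proof.
move=> u0; elim: n z => //= n IH z; apply: sumr_ge0 => i _.
by rewrite !mulr_ge0.
Qed.

Lemma excursion_ge0 n u : (forall z, 0 <= u z) -> 0 <= excursion n u.
Proof.
by move=> u0; apply: sumr_ge0 => j _; rewrite !mulr_ge0 // killed_iter_ge0.
Qed.

Lemma killed_iter_fst n (f : alph k -> R) i v w :
  iter n killed (fun z => f z.1) (i, v) = iter n killed (fun z => f z.1) (i, w).
Proof.
elim: n i v w => //= n IH i v w; rewrite !killedE; apply: eq_bigr => j _ /=.
by congr (_ * _); exact: IH.
Qed.

Lemma qsum_killed (f : alph k -> R) n :
  \sum_(0 <= m < n) excursion m (fun z => f z.1) +
  \sum_(j : alph k) q j * iter n killed (fun z => f z.1) (j, point) =
  \sum_(j : alph k) q j * f j.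
Proof.
elim: n => [|n IH]; first by rewrite big_geq // add0r.
rewrite -IH big_nat_recr //= -addrA; congr (_ + _).
pose g j := iter n killed (fun z => f z.1) (j, point).
rewrite (_ : \sum_j q j * killed _ _ =
  \sum_j q j * \sum_i (~~ sing i)%:R * p i j * g i); last first.
  apply: eq_bigr => j _; rewrite killedE; congr (_ * _); apply: eq_bigr => i _.
  by congr (_ * _); exact: killed_iter_fst.
under [X in _ + X]eq_bigr do rewrite mulr_sumr.
rewrite exchange_big -big_split; apply: eq_bigr => i _ /=.
rewrite (killed_iter_fst n f i _ point) -/(g i).
rewrite (_ : \sum_j _ = (~~ sing i)%:R * g i * \sum_j p i j * q j); last first.
  by rewrite mulr_sumr; apply: eq_bigr => j _; ring.
by rewrite q_stat; case: (sing i); rewrite /=; ring.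
Qed.

Lemma killed_iter_cvg0 : \sum_(j : alph k) q j * iter n killed (fun=> 1) (j, point)
  @[n --> \oo] --> (0 : R).
Proof.
have [m [c /andP[c0 c1] Hc]] := Pn_lower p_ge0 p_sum1 p_prim s.
have le1 z : killed (fun=> 1) z <= 1.
  rewrite -[leRHS](Qop_cst A p_sum1 1 z); apply: Qop_le => // z'.
  by rewrite mulr1; case: (~~ _).
have kQ n u z : (forall z, 0 <= u z) -> iter n killed u z <= iter n Q u z.
  move=> u0; elim: n z => //= n IH z; apply: Qop_le => // z'.
  apply: le_trans (IH z'); case: (~~ _); rewrite ?mul1r // mul0r.
  exact: killed_iter_ge0.
have step z : iter m.+1 killed (fun=> 1) z <= 1 - c.
  rewrite iterSr.
  apply: le_trans (kQ m _ z _) _ => [z'|]; first by apply: sumr_ge0 => i _; rewrite !mulr_ge0.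
  rewrite -iterSr (_ : (fun _ => _) = (fun z => 1 + (-1) * (sing z.1)%:R)); last first.
    by apply/funext => z'; rewrite mulr1; case: (sing _) => /=; ring.
  rewrite (Qiter_affine A p_sum1 m.+1 1 (-1) (fun z => (sing z.1)%:R)).
  rewrite mulN1r lerB //.
  have := Qiter_lower p_ge0 s_sing m z (u := fun z => (sing z.1)%:R) (fun=> ler0n _ _).
  by rewrite /= /sing s_sing eqxx mulr1; apply: le_trans.
have geo N z : iter (N * m.+1) killed (fun=> 1) z <= (1 - c) ^+ N.
  elim: N z => // N IH z; rewrite mulSnr iterD exprSr.
  apply: le_trans (_ : iter (N * m.+1) killed (fun=> (1 - c) * 1) z <= _).
    by apply: killed_iter_le => z'; rewrite mulr1.
  by rewrite killed_iterZ mulrC ler_wpM2r ?subr_ge0.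
have dec a b z : iter (a + b) killed (fun=> 1) z <= iter a killed (fun=> 1) z.
  rewrite iterD; apply: killed_iter_le => {}z; elim: b z => //= b IH z.
  by apply: le_trans (le1 z); exact: killed_le.
apply/cvgrPdist_le => e e0.
have cv : (1 - c) ^+ N @[N --> \oo] --> (0 : R).
  by apply: cvg_expr; rewrite ger0_norm; lra.
have /cvgrPdist_le/(_ _ e0)[N _ /(_ N (leqnn N))] := cv.
rewrite /= sub0r normrN ger0_norm ?exprn_ge0 ?subr_ge0 // => HN.
exists (N * m.+1)%N => // n /= Hn; rewrite sub0r normrN ger0_norm; last first.
  by apply: sumr_ge0 => j _; rewrite mulr_ge0 // killed_iter_ge0.
have E : (1 - c) ^+ N = \sum_(j : alph k) q j * (1 - c) ^+ N.
  by rewrite -mulr_suml q_sum1 mul1r.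
rewrite E in HN.
apply: le_trans HN; apply: ler_sum => j _; rewrite ler_wpM2l //; apply: le_trans (geo N (j, point)).
by rewrite -(subnKC Hn) dec.
Qed.

Lemma excursion_fst_cvg (f : alph k -> R) M : (forall j, 0 <= f j <= M) ->
  \sum_(0 <= m < n) excursion m (fun z => f z.1) @[n --> \oo] -->
  \sum_(j : alph k) q j * f j.
Proof.
move=> fM; rewrite -[X in _ --> X]subr0.
rewrite (_ : (fun n => \sum_(0 <= m < n) _) = (fun n => \sum_(j : alph k) q j * f j -
   \sum_(j : alph k) q j * iter n killed (fun z => f z.1) (j, point))); last first.
  by apply/funext => n; rewrite -(qsum_killed f n) addrK.
apply: cvgB; first exact: cvg_cst.
apply: (@squeeze_cvgr _ _ _ _ (fun=> 0)
  (fun n => M * \sum_(j : alph k) q j * iter n killed (fun=> 1) (j, point))).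
- apply: nearW => n; apply/andP; split.
    apply: sumr_ge0 => j _; rewrite mulr_ge0 // killed_iter_ge0 // => z.
    by case/andP: (fM z.1).
  rewrite mulr_sumr; apply: ler_sum => j _; rewrite mulrCA ler_wpM2l //.
  rewrite -killed_iterZ; apply: killed_iter_le => z.
  by rewrite mulr1; case/andP: (fM z.1).
- exact: cvg_cst.
- rewrite -[X in _ --> X](mulr0 M); apply: cvgMl_tmp; exact: killed_iter_cvg0.
Qed.

Lemma killed_weight_ge0 (i j : alph k) : 0 <= (~~ sing i)%:R * p i j.
Proof. by rewrite mulr_ge0. Qed.

Fixpoint kap (n : nat) (z : Z) : {measure set Z -> \bar R} :=
  if n is n'.+1 then
    msum (fun i => mscale (NngNum (killed_weight_ge0 (inord i) z.1))
                          (kap n' (inord i, pact (A (inord i)) z.2))) k.+1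
  else dirac z.

Lemma sum_inord (V : nmodType) (F : alph k -> V) :
  \sum_(i < k.+1) F (inord i) = \sum_(i : alph k) F i.
Proof. by apply: eq_bigr => i _; rewrite inord_val. Qed.

Lemma integral_kap n u z : measurable_fun setT u -> (forall z, 0 <= u z) ->
  (\int[kap n z]_z (u z)%:E = (iter n killed u z)%:E)%E.
Proof.
move=> mu u0; have meu : measurable_fun setT (EFin \o u) by exact/measurable_EFinP.
have eu0 z' : setT z' -> (0 <= (EFin \o u) z')%E by rewrite lee_fin.
elim: n z => [|n IH] z /=.
  by rewrite integral_dirac // diracT mul1e.
rewrite ge0_integral_measure_sum // killedE -sumEFin -[RHS]sum_inord.
by apply: eq_bigr => i _; rewrite ge0_integral_mscale //= IH -EFinM.
Qed.

Lemma start_weight_ge0 (j : alph k) : 0 <= (sing j)%:R * q j.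
Proof. by rewrite mulr_ge0. Qed.

Definition eta_measure : {measure set Z -> \bar R} :=
  mseries (fun n => msum (fun i =>
    mscale (NngNum (start_weight_ge0 (inord i))) (kap n (base (inord i)))) k.+1) 0.

Lemma integral_eta_measure u : measurable_fun setT u -> (forall z, 0 <= u z) ->
  (\int[eta_measure]_z (u z)%:E = \sum_(n <oo) (excursion n u)%:E)%E.
Proof.
move=> mu u0; have meu : measurable_fun setT (EFin \o u) by exact/measurable_EFinP.
have eu0 z' : setT z' -> (0 <= (EFin \o u) z')%E by rewrite lee_fin.
rewrite ge0_integral_measure_series //; apply: eq_eseriesr => n _.
rewrite ge0_integral_measure_sum // -sumEFin -[RHS]sum_inord.
by apply: eq_bigr => i _; rewrite ge0_integral_mscale //= integral_kap // -EFinM.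
Qed.

Lemma excursion_series_cvg u : (forall z, 0 <= u z) -> measurable_fun setT u ->
  (\sum_(0 <= n < N) excursion n u)%:E @[N --> \oo] -->
  (\int[eta_measure]_z (u z)%:E)%E.
Proof.
move=> u0 mu; rewrite integral_eta_measure //.
under eq_fun do rewrite -sumEFin.
by apply: is_cvg_nneseries => n _ _; rewrite lee_fin excursion_ge0.
Qed.

Lemma eta_measure_setT : eta_measure setT = 1%E.
Proof.
have := excursion_series_cvg (fun=> ler01) (measurable_cst (1 : R)).
rewrite integral_cst // mul1e => cv.
have := @excursion_fst_cvg (fun=> 1) 1 (fun=> ltac:(by rewrite ler01 lexx)).
under [X in _ --> X]eq_bigr do rewrite mulr1.
rewrite q_sum1 => /cvg_EFin_seq cv'.
exact: cvg_unique cv cv'.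
Qed.

Lemma excursionD n u u' :
  excursion n (fun z => u z + u' z) = excursion n u + excursion n u'.
Proof.
by rewrite -big_split; apply: eq_bigr => j _; rewrite killed_iterD mulrDr.
Qed.

Lemma exists_stationary : exists eta : probability Z R, Q_stationary p A eta.
Proof.
pose eta : probability Z R := mnormalize eta_measure (dirac point).
have etaE : (eta : set Z -> \bar R) = eta_measure.
  apply/funext => B; rewrite /eta /= /mnormalize eta_measure_setT.
  by rewrite onee_eq0 /= invr1 mule1.
have bQ u : bounded_measurable u -> bounded_measurable (Q u).
  exact: (bounded_measurable_Qiter A_rank p_ge0 p_sum1 1).
have cv u : bounded_measurable u -> (forall z, 0 <= u z) ->
    \sum_(0 <= n < N) excursion n u @[N --> \oo] --> \int[eta]_z u z.
  move=> bu u0; have := excursion_series_cvg u0 bu.1.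
  rewrite -etaE -(EFin_mean eta bu) => h.
  exact: (fine_cvg h).
have pos u : bounded_measurable u -> (forall z, 0 <= u z) ->
    \int[eta]_z Q u z = \int[eta]_z u z.
  move=> bu u0; have [_ [M uM]] := bu.
  pose us z := (sing z.1)%:R * u z; pose f j := Q us (j, point).
  have QE : Q u = fun z => killed u z + f z.1.
    apply/funext => z; rewrite /f killedE -big_split; apply: eq_bigr => i _ /=.
    rewrite /us /=; case e: (sing i); rewrite /= !mul0r mul1r ?addr0 ?add0r; last by rewrite mulrC.
    by rewrite /pact; move: e; rewrite /sing => ->.
  have qf : \sum_(j : alph k) q j * f j = excursion 0 u.
    under eq_bigr do rewrite /f QopE mulr_sumr.
    rewrite exchange_big; apply: eq_bigr => i _ /=; rewrite /us /=.
    case e: (sing i); last by rewrite /= !mul0r big1 // => j _; rewrite !mul0r mulr0.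
    transitivity (u (base i) * \sum_j p i j * q j); last by rewrite q_stat mul1r mulrC.
    rewrite mulr_sumr; apply: eq_bigr => j _.
    by rewrite /base /pact; move: (e); rewrite /sing => -> /=; ring.
  have f01 j : 0 <= f j <= M.
    have us0 z : 0 <= us z <= M.
      rewrite mulr_ge0 //=; apply: le_trans (uM z).
      by rewrite ger0_norm // /us; case: (sing _); rewrite ?mul1r ?mul0r.
    exact: (Qiter_bounds A p_ge0 p_sum1 1 us0 (j, point)).
  have Qu0 z : 0 <= Q u z by apply: sumr_ge0 => i _; rewrite mulr_ge0.
  suff cv2 : \sum_(0 <= n < N) excursion n (Q u) @[N --> \oo] --> \int[eta]_z u z.
    exact: cvg_unique (cv _ (bQ _ bu) Qu0) cv2.
  have -> : (fun N => \sum_(0 <= n < N) excursion n (Q u)) =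
      (fun N => \sum_(0 <= n < N.+1) excursion n u - excursion 0 u +
                \sum_(0 <= n < N) excursion n (fun z => f z.1)).
    apply/funext => N.
    have -> : \sum_(0 <= n < N.+1) excursion n u - excursion 0 u =
        \sum_(0 <= n < N) excursion n.+1 u by rewrite big_nat_recl // addrC addKr.
    rewrite -big_split; apply: eq_bigr => n _ /=; rewrite QE excursionD.
    by congr (_ + _); apply: eq_bigr => j _; rewrite iterSr.
  rewrite -[X in _ --> X](subrK (excursion 0 u)).
  apply: cvgD; last by rewrite -qf; exact: excursion_fst_cvg f01.
  apply: cvgB; last exact: cvg_cst.
  by have := cv _ bu u0; rewrite -(cvg_shiftS (fun N => \sum_(0 <= n < N) excursion n u)).
exists eta => phi mphi [M phiM].
have bphi : bounded_measurable phi by split => //; exists M.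
rewrite -!EFin_mean //; last exact: bQ.
congr EFin; pose u z := M + phi z.
have bu : bounded_measurable u.
  split; first by apply: measurable_funD => //.
  by exists (`|M| + M) => z; rewrite (le_trans (ler_normD _ _)) // lerD.
have u0 z : 0 <= u z.
  by rewrite /u; have := phiM z; rewrite ler_norml => /andP[+ _]; rewrite -subr_ge0 opprK addrC.
have bM := bounded_measurable_cst k M.
have := pos u bu u0; rewrite /u.
have -> : (fun z => Q (fun z => M + phi z) z) = (fun z => M + Q phi z).
  by apply/funext => z; rewrite QopD Qop_cst.
have iM := bounded_integrable eta bM.
have iphi := bounded_integrable eta bphi.
have iQ := bounded_integrable eta (bQ _ bphi).
by rewrite !RintegralD // => /addrI.
Qed.

End Existence.

Lemma cvg_bounded_inv (R : realType) (b : nat -> R) M : (forall n, `|b n| <= M) ->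
  n%:R^-1 * b n @[n --> \oo] --> (0 : R).
Proof.
move=> bM; have M0 : 0 <= M by apply: le_trans (bM 0%N).
apply/cvgrPdist_le => e e0; exists (Num.bound (M / e)).+1 => // n /= Hn.
have n0 : 0 < n%:R :> R by rewrite ltr0n; lia.
rewrite sub0r normrN normrM gtr0_norm ?invr_gt0 // ler_pdivrMl //.
apply: le_trans (bM n) _; rewrite -ler_pdivrMr //.
have := archi_boundP (divr_ge0 M0 (ltW e0)) => /ltW/le_trans; apply.
by rewrite ler_nat; exact: ltnW.
Qed.

Section TruncatedLog.
Variable R : realType.

Definition tln (L : nat) (x : R) : R := ln (Num.max x (expR (- L%:R))).

Lemma tln_ge L x : - L%:R <= tln L x.
Proof.
rewrite -[leLHS]expRK /tln ler_ln ?posrE ?expR_gt0 ?lt_max ?expR_gt0 ?orbT //.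
by rewrite le_max lexx orbT.
Qed.

Lemma tln_ge_ln L x : 0 < x -> ln x <= tln L x.
Proof.
by move=> x0; rewrite /tln ler_ln ?posrE ?lt_max ?x0 // le_max lexx.
Qed.

Lemma tln_le_expR L x y : 0 <= y -> x <= expR y -> tln L x <= y.
Proof.
move=> y0 xy; rewrite -[leRHS]expRK ler_ln ?posrE ?expR_gt0 ?lt_max ?expR_gt0 ?orbT //.
by rewrite ge_max xy ler_expR; have := ler0n R L; lra.
Qed.

Lemma tlnE L x : 0 < x -> - L%:R <= ln x -> tln L x = ln x.
Proof.
by move=> x0 Lx; rewrite /tln (max_idPl _) // -[leRHS]lnK ?posrE // ler_expR.
Qed.

Lemma tln0 L : tln L 0 = - L%:R.
Proof. by rewrite /tln (max_idPr _) ?expR_ge0 // expRK. Qed.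

Lemma tln_nonincr L L' x : (L <= L')%N -> tln L' x <= tln L x.
Proof.
move=> LL'; rewrite ler_ln ?posrE ?lt_max ?expR_gt0 ?orbT //.
rewrite ge_max !le_max lexx /=; apply/orP; right.
by rewrite ler_expR lerN2 ler_nat.
Qed.

Lemma tln_bounded L x y : 0 <= y -> x <= expR y -> `|tln L x| <= y + L%:R.
Proof.
move=> y0 xy; have := tln_ge L x; have := tln_le_expR L y0 xy.
by have := ler0n R L; rewrite ler_norml => *; apply/andP; split; lra.
Qed.

Lemma measurable_tln L : measurable_fun setT (tln L).
Proof.
apply: (measurableT_comp (@measurable_ln R)).
by apply: measurable_maxr => //; exact: measurable_cst.
Qed.

End TruncatedLog.

Section Averages.
Variables (R : realType) (k : nat) (A : alph k -> 'M[R]_2).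
Variables (p : alph k -> alph k -> R) (q : alph k -> R).
Hypothesis A_rank : forall i, (\rank (A i) == 1%N) || (A i \in unitmx).
Hypothesis p_ge0 : forall i j, 0 <= p i j.
Hypothesis p_sum1 : forall j, \sum_i p i j = 1.
Hypothesis p_prim : primitive p.
Hypothesis q_ge0 : forall j, 0 <= q j.
Hypothesis q_sum1 : \sum_j q j = 1.
Hypothesis q_stat : forall i, \sum_j p i j * q j = q i.
Variable s : alph k.
Hypothesis s_sing : \rank (A s) = 1%N.
Variables (d : measure_display) (Omega : measurableType d).
Variables (Pr : probability Omega R) (X : nat -> Omega -> alph k).
Hypothesis X_chain : markov_chain p Pr q X.

Local Notation Z := (alph k * P1 R)%type.
Local Notation Q := (Qop p A).
Local Notation s0 := (ord0 : alph k).
Implicit Types (u : Z -> R) (z : Z).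
Variable eta : probability Z R.
Hypothesis eta_stat : Q_stationary p A eta.

Lemma state_lln u : bounded_measurable u ->
  {ae Pr, forall o, n%:R^-1 * \sum_(0 <= l < n) u (state A (past X l o))
    @[n --> \oo] --> \int[eta]_z u z}.
Proof.
move=> bu; have [_ [M uM]] := bu.
have uN N z := Qiter_bounded A p_ge0 p_sum1 N uM z.
pose F N w := iter N Q u (state A w).
have HF N : {ae Pr, forall o, n%:R^-1 * martingale s0 p (F N) (past X n o)
    @[n --> \oo] --> (0 : R)}.
  by apply: (@martingale_lln _ _ p q p_ge0 p_sum1 q_ge0 q_sum1 _ _ _ X X_chain _ M) => w; exact: uN.
have := ae_foralln HF; apply: filterS => o Ho.
pose a N n := n%:R^-1 * \sum_(0 <= l < n) F N (past X l o).
have step N : a N n - a N.+1 n @[n --> \oo] --> (0 : R).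
  have h := cvgB (Ho N)
    (@cvg_bounded_inv _ (fun n => F N (past X n o) - F N (past X 0 o)) (M + M) _).
  rewrite -[X in _ --> X](subr0 0).
  rewrite (_ : (fun n => _) = (fun n => n%:R^-1 * martingale s0 p (F N) (past X n o)
      - n%:R^-1 * (F N (past X n o) - F N (past X 0 o)))).
    by apply: h => n; rewrite (le_trans (ler_normB _ _)) // lerD // uN.
  apply/funext => n; rewrite martingale_past /a -!mulrBr; congr (_ * _).
  rewrite -(telescope_sumr (fun l => F N (past X l o))) // -!sumrB.
  by apply: eq_bigr => l _; rewrite predict_state /F iterS; ring.
have all N : a 0%N n - a N n @[n --> \oo] --> (0 : R).
  elim: N => [|N IH].
    by under eq_fun do rewrite subrr; exact: cvg_cst.
  rewrite -[X in _ --> X](addr0 0) (_ : (fun n => _) =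
    (fun n => (a 0%N n - a N n) + (a N n - a N.+1 n))).
    exact: cvgD.
  by apply/funext => n; ring.
apply/cvgrPdist_le => e e0; have e3 : 0 < e / 3 by rewrite divr_gt0.
have [N [c Hc]] := Qiter_near_cst p_ge0 p_sum1 p_prim s_sing uM e3.
have mc : `|\int[eta]_z u z - c| <= e / 3.
  rewrite -(stationary_mean A_rank p_ge0 p_sum1 N eta_stat bu).
  apply: mean_near => //; exact: bounded_measurable_Qiter.
have /cvgrPdist_le/(_ _ e3)[n1 _ Hn1] := all N.
exists n1.+1 => // n /= Hn; have n0 : n%:R != 0 :> R by rewrite pnatr_eq0; lia.
have /= := Hn1 n (ltnW Hn); rewrite sub0r normrN => h1.
have h2 : `|a N n - c| <= e / 3.
  have -> : a N n - c = n%:R^-1 * \sum_(0 <= l < n) (F N (past X l o) - c).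
    by rewrite sumrB sumr_const_nat subn0 mulrBr -[c *+ n]mulr_natl mulKf.
  rewrite normrM ger0_norm ?invr_ge0 // ler_pdivrMl; last by rewrite lt_def n0 ler0n.
  apply: le_trans (ler_norm_sum _ _ _) _.
  apply: le_trans (_ : \sum_(0 <= l < n) (e / 3) <= _); first by apply: ler_sum => l _; exact: Hc.
  by rewrite sumr_const_nat subn0 mulr_natl.
rewrite -[X in _ - X]/(a 0%N n).
move: h1 h2 mc; rewrite !ler_norml => /andP[? ?] /andP[? ?] /andP[? ?].
by apply/andP; split; lra.
Qed.

Lemma matrix_bound : exists2 C : R, 0 <= C &
  forall i (x : P1 R), vnorm (A i *m p1v x) <= expR C.
Proof.
pose N i := \sum_a \sum_b `|A i a b|.
exists (\sum_(i : alph k) 2 * N i) => [|i x].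
  by apply: sumr_ge0 => i _; rewrite mulr_ge0 // !sumr_ge0 // => a _; rewrite sumr_ge0.
have entry b : `|p1v x b 0| <= 1.
  have := vnorm_p1v x; rewrite /vnorm => n1.
  rewrite -n1 -sqrtr_sqr ler_wsqrtr //; move: b; apply: ord2P.
    by rewrite lerDl sqr_ge0.
  by rewrite lerDr sqr_ge0.
have row a : `|(A i *m p1v x) a 0| <= N i.
  rewrite mxE; apply: le_trans (ler_norm_sum _ _ _) _.
  apply: le_trans (_ : \sum_b `|A i a b| <= _).
    by apply: ler_sum => b _; rewrite normrM ler_piMr.
  rewrite /N [leRHS](bigD1 a) //= lerDl sumr_ge0 // => c _.
  by rewrite sumr_ge0.
have N0 : 0 <= N i by apply: le_trans (row 0).
have v2 : vnorm (A i *m p1v x) <= 2 * N i.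
  rewrite -[leRHS]ger0_norm ?mulr_ge0 // -sqrtr_sqr ler_wsqrtr //.
  have sq a : (A i *m p1v x) a 0 ^+ 2 <= N i ^+ 2.
    by rewrite -real_normK ?num_real // lerXn2r ?nnegrE.
  by have := sq 0; have := sq 1; have := sqr_ge0 (N i); nra.
apply: le_trans v2 _; apply: le_trans (_ : \sum_(i : alph k) 2 * N i <= _).
  rewrite (bigD1 i) //= lerDl sumr_ge0 // => j _.
  by rewrite mulr_ge0 // sumr_ge0 // => a _; rewrite sumr_ge0.
by apply: le_trans (expR_ge1Dx _); rewrite lerDr.
Qed.

Definition growth (w : seq (alph k)) : R :=
  if w is i :: w' then vnorm (A i *m p1v (direction A w')) else 0.

Definition Psi_trunc (L : nat) z : R :=
  \sum_(i : alph k) p i z.1 * tln L (vnorm (A i *m p1v z.2)).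

Lemma bounded_measurable_Psi_trunc L : bounded_measurable (Psi_trunc L).
Proof.
have [C C0 HC] := matrix_bound; split.
  apply: measurable_sum => i; apply: measurable_funM.
    exact: (measurableT_comp (measurable_alph (p i)) measurable_fst).
  apply: (measurableT_comp (measurable_tln L)).
  exact: (measurableT_comp (measurable_vnorm_mulmx (A i)) measurable_snd).
exists (C + L%:R) => z; apply: le_trans (ler_norm_sum _ _ _) _.
rewrite [leRHS](_ : _ = \sum_(i : alph k) p i z.1 * (C + L%:R)); last first.
  by rewrite -mulr_suml p_sum1 mul1r.
apply: ler_sum => i _; by rewrite normrM ger0_norm // ler_wpM2l // tln_bounded.
Qed.

Definition Psi_mean L : R := \int[eta]_z Psi_trunc L z.

Lemma trunc_lln L :
  {ae Pr, forall o, n%:R^-1 * \sum_(0 <= l < n) tln L (growth (past X l.+1 o))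
    @[n --> \oo] --> Psi_mean L}.
Proof.
have [C C0 HC] := matrix_bound.
pose F w := tln L (growth w).
have FM w : `|F w| <= C + L%:R.
  apply: tln_bounded => //; case: w => [|i w] /=; last exact: HC.
  exact: expR_ge0.
have := state_lln (bounded_measurable_Psi_trunc L).
have := @martingale_lln _ _ p q p_ge0 p_sum1 q_ge0 q_sum1 _ _ _ X X_chain _ _ FM.
apply: filterS2 => o h1 h2.
rewrite -[X in _ --> X]add0r (_ : (fun n => _) = (fun n =>
  n%:R^-1 * martingale s0 p F (past X n o) +
  n%:R^-1 * \sum_(0 <= l < n) Psi_trunc L (state A (past X l o)))).
  exact: cvgD h1 h2.
apply/funext => n; rewrite martingale_past -mulrDr -big_split /=.
congr (_ * _); apply: eq_bigr => l _.
have -> : predict s0 p F (past X l o) = Psi_trunc L (state A (past X l o)) by [].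
by rewrite subrK.
Qed.

Lemma tail_control (c : R) : (forall L, c <= Psi_mean L) ->
  Psi_mean L @[L --> \oo] --> c ->
  {ae Pr, forall o, forall r, exists L, forall L' n,
    \sum_(0 <= l < n) (seen_singular A (past X l o))%:R *
      (tln L (growth (past X l.+1 o)) - tln (L + L') (growth (past X l.+1 o)))
    <= r.+1%:R^-1 * n%:R}.
Proof.
move=> cle cv.
pose y L L' w := (seen_singular A (behead w))%:R *
  (tln L (growth w) - tln (L + L') (growth w)).
have y0 L L' w : 0 <= y L L' w.
  by rewrite mulr_ge0 // subr_ge0 tln_nonincr // leq_addr.
have ymono L L' w w' : y L L' w <= y L L' (w ++ w').
  case: w => [|i w]; first by rewrite /y /= mul0r; exact: y0.
  rewrite /y /=; case e: (seen_singular A w); last first.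
    by rewrite mul0r; exact: (y0 L L' (i :: (w ++ w'))).
  by rewrite direction_cat // /seen_singular has_cat -/(seen_singular A w) e.
have yL L L' w : y L L' w <= y L L'.+1 w.
  by rewrite /y ler_wpM2l // lerD2l lerN2 tln_nonincr // addnS.
have yE L L' l : Ew s0 p q l.+1 (y L L') <= Psi_mean L - c.
  pose u z := Psi_trunc L z - Psi_trunc (L + L') z.
  have bu : bounded_measurable u.
    by apply: bounded_measurableB; exact: bounded_measurable_Psi_trunc.
  have u0 z : 0 <= u z.
    by rewrite subr_ge0; apply: ler_sum => i _; rewrite ler_wpM2l // tln_nonincr // leq_addr.
  have -> : Ew s0 p q l.+1 (y L L') =
      Ew s0 p q l (fun w => (seen_singular A w)%:R * u (state A w)).
    rewrite EwS; apply: eq_Ew => // w _; rewrite /u -sumrB mulr_sumr.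
    by apply: eq_bigr => i _; rewrite /y /=; ring.
  apply: le_trans (Ew_seen_singular_le A_rank p_ge0 p_sum1 p_prim q_ge0 q_sum1
    q_stat s_sing l eta_stat bu u0) _.
  rewrite RintegralB //; try by apply: bounded_integrable; exact: bounded_measurable_Psi_trunc.
  exact: lerB (lexx _) (cle (L + L')%N).
apply: ae_foralln => r; set lam := r.+1%:R^-1.
have lam0 : 0 < lam by rewrite invr_gt0.
have HB L := maximal_prob p_ge0 p_sum1 q_ge0 q_sum1 q_stat X_chain
  (y0 L) (ymono L) (yL L) lam0 (yE L).
have /choice[B HB'] : forall L, exists B, measurable B /\
    (Pr B <= ((Psi_mean L - c) / lam)%:E)%E /\
    forall o, ~ B o -> forall L' n, \sum_(0 <= l < n) y L L' (past X l.+1 o) <= lam * n%:R.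
  by move=> L; have [B mB [h1 h2]] := HB L; exists B.
have mI : measurable (\bigcap_L B L) by apply: bigcapT_measurable => L; have [] := HB' L.
exists (\bigcap_L B L); split => //.
  apply/eqP; rewrite eq_le measure_ge0 andbT; apply/lee_addgt0Pr => e e0; rewrite add0e.
  have el : 0 < e * lam by rewrite mulr_gt0.
  have /cvgrPdist_le/(_ _ el)[L _ /(_ L (leqnn L))] := cv.
  rewrite /= distrC ger0_norm ?subr_ge0 // => HL.
  have [mB [PB _]] := HB' L.
  apply: le_trans (le_measure Pr _ _ (_ : \bigcap_L B L `<=` B L)) _; rewrite ?inE //.
    exact: bigcap_inf.
  by apply: le_trans PB _; rewrite lee_fin ler_pdivrMr.
move=> o /= no L _; apply: contrapT => nB; apply: no; exists L => L' n.
have [_ [_ H]] := HB' L; apply: le_trans (H o nB L' n).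
by rewrite le_eqVlt; apply/orP; left; apply/eqP; apply: eq_bigr => l _.
Qed.

Lemma exists_singular_time :
  {ae Pr, forall o, exists2 n, (0 < n)%N & \rank (A (X n o)) = 1%N}.
Proof.
pose u z : R := (z.1 == s)%:R.
have bu : bounded_measurable u := bounded_measurable_fst (fun i => (i == s)%:R).
have u0 z : 0 <= u z by [].
have := state_lln bu; apply: filterS => o cv; apply: contrapT => no.
have [m [c /andP[c0 _] Hc]] := Pn_lower p_ge0 p_sum1 p_prim s.
have : c <= \int[eta]_z u z.
  rewrite -(stationary_mean A_rank p_ge0 p_sum1 m.+1 eta_stat bu) -(mean_cst eta c).
  apply: mean_le; [exact: bounded_measurable_cst|exact: bounded_measurable_Qiter|].
  move=> z; apply: le_trans (Qiter_lower p_ge0 s_sing m z u0).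
  by rewrite /u /= eqxx mulr1.
suff -> : \int[eta]_z u z = 0 by rewrite leNgt c0.
pose b n := \sum_(0 <= l < n) u (state A (past X l o)).
suff b1 n : `|b n| <= 1 by exact: cvg_unique cv (cvg_bounded_inv b1).
rewrite /b ger0_norm ?sumr_ge0 //; case: n => [|n]; first by rewrite big_geq.
rewrite big_nat_recl // big1 ?addr0; first by rewrite /u lern1 leq_b1.
move=> l _; rewrite /u /=; case: eqP => // Xs; exfalso; apply: no.
by exists l.+1; rewrite // Xs.
Qed.

End Averages.

Section PsiIntegral.
Variables (R : realType) (k : nat) (A : alph k -> 'M[R]_2).
Variables (p : alph k -> alph k -> R).
Hypothesis p_ge0 : forall i j, 0 <= p i j.
Hypothesis p_sum1 : forall j, \sum_i p i j = 1.
Variable eta : probability (alph k * P1 R)%type R.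
Local Notation Z := (alph k * P1 R)%type.
Implicit Types z : Z.

Let x i z := vnorm (A i *m p1v z.2).

Lemma PsiE z : Psi p A z = (\sum_(i : alph k) (p i z.1)%:E * elog (x i z))%E.
Proof. by apply: eq_bigr => i _; rewrite vnorm_p1v divr1. Qed.

Lemma Psi_trunc_nonincr L L' z : (L <= L')%N -> Psi_trunc A p L' z <= Psi_trunc A p L z.
Proof. by move=> LL'; apply: ler_sum => i _; rewrite ler_wpM2l // tln_nonincr. Qed.

Lemma elog_le_tln L (y : R) : 0 <= y -> (elog y <= (tln L y)%:E)%E.
Proof.
move=> y0; rewrite /elog; case: eqP => [_|/eqP yn0]; first exact: leNye.
by rewrite lee_fin tln_ge_ln // lt_def yn0.
Qed.

Lemma Psi_le_trunc L z : (Psi p A z <= (Psi_trunc A p L z)%:E)%E.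
Proof.
rewrite PsiE -sumEFin; apply: lee_sum => i _; rewrite EFinM lee_wpmul2l ?lee_fin //.
by rewrite elog_le_tln // vnorm_ge0.
Qed.

Lemma Psi_trunc_cvg z : (Psi_trunc A p L z)%:E @[L --> \oo] --> Psi p A z.
Proof.
have [C C0 HC] := matrix_bound A.
case: (boolP [exists i : alph k, (p i z.1 != 0) && (x i z == 0)]).
  move=> /existsP[i /andP[pi0 /eqP xi0]].
  have pi : 0 < p i z.1 by rewrite lt_def pi0 p_ge0.
  have -> : Psi p A z = -oo%E.
    rewrite PsiE; apply/eqP; rewrite esum_eqNy; apply/existsP; exists i.
    by rewrite xi0 /elog eqxx gt0_muleNy ?lte_fin //= eqxx.
  apply/cvgeNyPle => M.
  have := archi_boundP (x := `|C - M| / p i z.1).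
  rewrite divr_ge0 // => /(_ isT); set L0 := Num.bound _; rewrite ltr_pdivrMr // => HL0.
  exists L0 => // L /= L0L; rewrite lee_fin.
  have b : Psi_trunc A p L z <= p i z.1 * (- L%:R) + C.
    rewrite /Psi_trunc (bigD1 i) //= -/(x i z) xi0 tln0 lerD2l.
    apply: le_trans (_ : \sum_(j : alph k) p j z.1 * C <= _); last first.
      by rewrite -mulr_suml p_sum1 mul1r.
    rewrite [leRHS](bigD1 i) //=; apply: ler_wpDl; first by rewrite mulr_ge0.
    by apply: ler_sum => j _; rewrite ler_wpM2l // tln_le_expR.
  apply: le_trans b _; have := ler_norm (C - M).
  have : p i z.1 * L0%:R <= p i z.1 * L%:R by rewrite ler_wpM2l // ler_nat.
  by move: HL0; rewrite mulrC mulrN; lra.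
move=> /existsPn H.
pose N := Num.bound (\sum_(i : alph k) `|ln (x i z)|).
apply: cvg_near_cst; exists N => // L /= NL; rewrite PsiE -sumEFin.
apply: eq_bigr => i _; rewrite EFinM; have := H i; rewrite negb_and negbK.
have [-> _|p0 /=] := eqVneq (p i z.1) 0; first by rewrite !mul0e.
move=> xn0; have x0 : 0 < x i z by rewrite lt_def xn0 vnorm_ge0.
rewrite /elog (negbTE xn0) -/(x i z) tlnE //.
have h1 : `|ln (x i z)| <= N%:R.
  apply: ltW; apply: le_lt_trans (archi_boundP _); last by apply: sumr_ge0.
  by rewrite (bigD1 i) //= lerDl sumr_ge0.
have h2 : N%:R <= L%:R :> R by rewrite ler_nat.
by move: h1; rewrite ler_norml => /andP[]; lra.
Qed.

Lemma integral_Psi_le L : (\int[eta]_z Psi p A z <= (Psi_mean A p eta L)%:E)%E.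
Proof.
have bm L' := bounded_measurable_Psi_trunc A p_ge0 p_sum1 L'.
have mP : measurable_fun setT (Psi p A).
  apply: (@emeasurable_fun_cvg _ _ _ setT (fun L' z => (Psi_trunc A p L' z)%:E)
    _ _ (fun z _ => @Psi_trunc_cvg z)) => L'.
  by apply/measurable_EFinP; exact: (bm L').1.
have mL : measurable_fun setT (fun z => (Psi_trunc A p L z)%:E).
  by apply/measurable_EFinP; exact: (bm L).1.
rewrite EFin_mean // integralE [leRHS]integralE; apply: leeB; apply: ge0_le_integral => //.
- exact: measurable_funepos.
- exact: measurable_funepos.
- by move=> z _; rewrite !funeposE; apply: le_max2; rewrite ?Psi_le_trunc.
- exact: measurable_funeneg.
- exact: measurable_funeneg.
- by move=> z _; rewrite !funenegE; apply: le_max2 => //; rewrite leeN2 Psi_le_trunc.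
Qed.

Lemma Psi_mean_cvg :
  (Psi_mean A p eta L)%:E @[L --> \oo] --> (\int[eta]_z Psi p A z)%E.
Proof.
have [C C0 HC] := matrix_bound A.
have bm L := bounded_measurable_Psi_trunc A p_ge0 p_sum1 L.
have TC L z : Psi_trunc A p L z <= C.
  rewrite [leRHS](_ : _ = \sum_(i : alph k) p i z.1 * C); last first.
    by rewrite -mulr_suml p_sum1 mul1r.
  by apply: ler_sum => i _; rewrite ler_wpM2l // tln_le_expR.
pose g L z := (C - Psi_trunc A p L z)%:E.
have bg L : bounded_measurable (fun z => C - Psi_trunc A p L z).
  by apply: bounded_measurableB => //; exact: bounded_measurable_cst.
have mg L : measurable_fun setT (g L) by apply/measurable_EFinP; exact: (bg L).1.
pose G z := (C%:E - Psi p A z)%E.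
have gG z : g L z @[L --> \oo] --> G z.
  rewrite /g; under eq_fun do rewrite EFinB.
  by apply: cvgeB => //; [exact: cvg_cst|exact: Psi_trunc_cvg].
have g0 L z : (0 <= g L z)%E by rewrite lee_fin subr_ge0.
have mG : measurable_fun setT G by apply: (@emeasurable_fun_cvg _ _ _ setT g _ _ (fun z _ => gG z)).
have G0 z : (0 <= G z)%E by apply: (cvge_to_ge (gG z)); exact: nearW.
have cv : (C - Psi_mean A p eta L)%:E @[L --> \oo] --> (\int[eta]_z G z)%E.
  have := @cvg_monotone_convergence _ _ _ eta setT measurableT g mg (fun n z _ => g0 n z) _.
  rewrite (_ : (fun n => _) = fun L => (C - Psi_mean A p eta L)%:E); last first.
    apply/funext => L; rewrite -EFin_mean // RintegralB //; last 2 first.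
    - by apply: bounded_integrable; exact: bounded_measurable_cst.
    - exact: bounded_integrable.
    by rewrite (mean_cst eta C).
  under eq_integral do rewrite (cvg_lim _ (gG _)) //.
  by apply => z _ L L' LL'; rewrite lee_fin lerB // Psi_trunc_nonincr.
have PG z : Psi p A z = (C%:E - G z)%E.
  by rewrite /G oppeB ?fin_num_adde_defr // addeA -EFinN -EFinD subrr add0e.
case E : (\int[eta]_z G z)%E cv => [r| |].
- move=> cv; have iG : eta.-integrable setT G.
    apply/integrableP; split => //.
    by under eq_integral do rewrite gee0_abs //; rewrite E ltry.
  have iC : eta.-integrable setT (EFin \o (fun=> C)).
    by apply: bounded_integrable; exact: bounded_measurable_cst.
  have -> : (\int[eta]_z Psi p A z = (C - r)%:E)%E.
    under eq_integral do rewrite PG.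
    rewrite (@integralB _ _ _ eta setT measurableT (EFin \o fun=> C) G iC iG) E.
    by rewrite -(EFin_mean eta (bounded_measurable_cst _ C)) (mean_cst eta C).
  apply: cvg_EFin_seq; have /= cv' := fine_cvg cv.
  have cvC : (fun=> C) n @[n --> \oo] --> C by exact: cvg_cst.
  have : C - (C - Psi_mean A p eta L) @[L --> \oo] --> C - r.
    by apply: (cvgB cvC); exact: cv'.
  by under eq_fun do rewrite subKr.
- move=> /cvgeyPge cv.
  suff cv' : (Psi_mean A p eta L)%:E @[L --> \oo] --> -oo%E.
    suff -> : (\int[eta]_z Psi p A z)%E = -oo%E by [].
    apply/eqP; rewrite -leeNy_eq.
    by apply: (cvge_to_ge cv'); apply: nearW => L; exact: integral_Psi_le.
  apply/cvgeNyPle => M; have := cv (C - M); apply: filterS => L /=.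
  by rewrite !lee_fin; lra.
- by move=> _; have := @integral_ge0 _ _ _ eta setT G (fun z _ => G0 z); rewrite E.
Qed.

End PsiIntegral.

Lemma cvg_near_eq (T : topologicalType) (f g : nat -> T) (l : T) :
  (\forall n \near \oo, f n = g n) -> f n @[n --> \oo] --> l ->
  g n @[n --> \oo] --> l.
Proof. by move=> fg fl; exact: (cvg_trans (near_eq_cvg fg) fl). Qed.

Section LogAverage.
Variables (R : realType) (a : nat -> R) (C : nat -> R) (I : \bar R) (c : R) (T : nat).
Hypothesis c_gt0 : 0 < c.
Hypothesis a_ge0 : forall l, 0 <= a l.
Hypothesis trunc_avg : forall L,
  n%:R^-1 * \sum_(0 <= l < n) tln L (a l) @[n --> \oo] --> C L.
Hypothesis C_cvg : (C L)%:E @[L --> \oo] --> I.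
Hypothesis I_le : forall L, (I <= (C L)%:E)%E.
Hypothesis tail : I \is a fin_num -> forall r, exists L, forall L' n,
  \sum_(0 <= l < n) (T <= l)%:R * (tln L (a l) - tln (L + L') (a l))
  <= r.+1%:R^-1 * n%:R.

Let P n := c * \prod_(T <= l < n) a l.
Let U L n := ln c + \sum_(T <= l < n) tln L (a l).

Let U_cvg L : n%:R^-1 * U L n @[n --> \oo] --> C L.
Proof.
pose b := ln c - \sum_(0 <= l < T) tln L (a l).
have cb := @cvg_bounded_inv R (fun=> b) `|b| (fun=> lexx _).
have h : n%:R^-1 * \sum_(0 <= l < n) tln L (a l) + n%:R^-1 * b
    @[n --> \oo] --> C L.
  by rewrite -[X in _ --> X]addr0; exact: cvgD (@trunc_avg L) cb.
apply: (cvg_near_eq _ h); exists T => // n /= Tn; rewrite -mulrDr; congr (_ * _).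
by rewrite (big_cat_nat (n := T)) //= /U /b; ring.
Qed.

Let elog_le L n : (elog (P n) <= (U L n)%:E)%E.
Proof.
rewrite /elog; case: eqP => [_|/eqP Pn0]; first exact: leNye.
have pr0 : \prod_(T <= l < n) a l != 0.
  by apply: contra Pn0 => /eqP e; rewrite /P e mulr0.
have prp : 0 < \prod_(T <= l < n) a l by rewrite lt_def pr0 prodr_ge0.
rewrite lee_fin /P lnM ?posrE // lerD2l.
elim: n {Pn0} pr0 prp => [|n IH].
  by rewrite !big_geq // ln1.
have [Tn|nT] := leqP T n; last by rewrite !big_geq // ln1.
rewrite !big_nat_recr //= mulf_eq0 negb_or => /andP[pr0 an0] _.
have an : 0 < a n by rewrite lt_def an0 a_ge0.
have prp : 0 < \prod_(T <= l < n) a l by rewrite lt_def pr0 prodr_ge0.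
by rewrite lnM ?posrE // lerD ?IH // tln_ge_ln.
Qed.

Let avg_le L e : 0 < e -> \forall n \near \oo,
  ((n%:R^-1)%:E * elog (P n) <= (C L + e)%:E)%E.
Proof.
move=> e0; have /cvgrPdist_le/(_ _ e0) := @U_cvg L; apply: filterS => n /=.
rewrite ler_distlC => /andP[_ h].
apply: le_trans (lee_wpmul2l _ (elog_le L n)) _; first by rewrite lee_fin invr_ge0.
by rewrite -EFinM lee_fin.
Qed.

Lemma log_average : ((n%:R^-1)%:E * elog (P n))%E @[n --> \oo] --> I.
Proof.
case: I C_cvg I_le tail => [x| |] Ccvg Ile tl; last 2 first.
- by have := Ile 0%N.
- apply/cvgeNyPle => M.
  have /cvgeNyPle/(_ (M - 1))[L _ /(_ L (leqnn L))] := Ccvg.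
  rewrite /= lee_fin => CL; have := avg_le L ltr01; apply: filterS => n /le_trans; apply.
  by rewrite lee_fin; lra.
have {}tl := tl isT.
have a_gt0 l : (T <= l)%N -> 0 < a l.
  move=> Tl; rewrite lt_def a_ge0 andbT; apply/eqP => al0.
  have [L HL] := tl 0%N.
  have := HL l.+2 l.+1; rewrite invr1 mul1r big_nat_recr //= Tl al0 !tln0 mul1r.
  have : 0 <= \sum_(0 <= i < l) (T <= i)%:R * (tln L (a i) - tln (L + l.+2) (a i)).
    by apply: sumr_ge0 => i _; rewrite mulr_ge0 // subr_ge0 tln_nonincr // leq_addr.
  by rewrite natrD -[l.+2%:R]natr1; lra.
have elogE n : elog (P n) = (ln c + \sum_(T <= l < n) ln (a l))%:E.
  have prp m : 0 < \prod_(T <= l < m) a l.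
    rewrite big_nat; apply: prodr_gt0 => l /andP[Tl _]; exact: a_gt0.
  rewrite /elog gt_eqF ?mulr_gt0 // lnM ?posrE //; congr (_ + _)%:E.
  elim: n => [|n IH]; first by rewrite !big_geq // ln1.
  have [Tn|nT] := leqP T n; last by rewrite !big_geq // ln1.
  by rewrite !big_nat_recr //= lnM ?posrE ?a_gt0 // IH.
have low L n r : (forall L', \sum_(0 <= l < n) (T <= l)%:R * (tln L (a l) - tln (L + L') (a l))
    <= r.+1%:R^-1 * n%:R) ->
    U L n - r.+1%:R^-1 * n%:R <= ln c + \sum_(T <= l < n) ln (a l).
  pose L' := Num.bound (\sum_(T <= l < n) `|ln (a l)|).
  move=> /(_ L') H; rewrite lerBlDr /U -addrA lerD2l -lerBlDl; apply: le_trans H.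
  rewrite -sumrB; have [Tn|nT] := leqP T n; last first.
    rewrite big_geq ?sumr_ge0 // ?(ltnW nT) // => i _.
    by rewrite mulr_ge0 // subr_ge0 tln_nonincr // leq_addr.
  rewrite [leRHS](big_cat_nat (n := T)) //=; apply: ler_wpDl.
    apply: sumr_ge0 => i _.
    by rewrite mulr_ge0 // subr_ge0 tln_nonincr // leq_addr.
  rewrite !big_nat; apply: ler_sum => l /andP[Tl ln]; rewrite Tl mul1r.
  rewrite lerD2l lerN2 le_eqVlt; apply/orP; left; apply/eqP; apply: tlnE; first exact: a_gt0.
  have h1 : `|exp.ln (a l)| <= L'%:R.
    apply: ltW; apply: le_lt_trans (archi_boundP _); last by apply: sumr_ge0.
    rewrite (big_cat_nat (n := l)) ?(ltnW ln) //= (big_ltn ln).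
    by rewrite addrCA lerDl addr_ge0 ?sumr_ge0.
  rewrite natrD; have := ler0n R L; move: h1; rewrite ler_norml => /andP[]; lra.
under eq_fun do rewrite elogE -EFinM.
apply: cvg_EFin_seq; apply/cvgrPdist_le => e e0.
have e2 : 0 < e / 2 by rewrite divr_gt0.
have [r Hr] : exists r : nat, r.+1%:R^-1 <= e / 2.
  exists (Num.bound (e / 2)^-1); rewrite invf_ple ?posrE //.
  have /ltW := archi_boundP (x := (e / 2)^-1) ltac:(by rewrite invr_ge0 ltW).
  by move/le_trans; apply; rewrite ler_nat.
have [L HL] := tl r.
have Ccv : C L @[L --> \oo] --> x by exact: (fine_cvg Ccvg).
have /cvgrPdist_le/(_ _ e2)[L1 _ /(_ L1 (leqnn L1))] := Ccv.
rewrite /= ler_distlC => /andP[_ HL1].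
have up := avg_le L1 e2.
have /cvgrPdist_le/(_ _ e2) := @U_cvg L.
move: up; apply: filterS2 => n; rewrite elogE -EFinM lee_fin => h1.
rewrite /= ler_distlC => /andP[h2 _].
have CL : x <= C L by have := Ile L; rewrite lee_fin.
have h3 : n%:R^-1 * U L n - r.+1%:R^-1 <= n%:R^-1 * (ln c + \sum_(T <= l < n) ln (a l)).
  case: n {h1 h2} => [|n]; first by rewrite invr0 !mul0r subr_le0 invr_ge0.
  have n0 : 0 < n.+1%:R :> R by rewrite ltr0n.
  have := low L n.+1 r (fun L' => HL L' n.+1).
  rewrite -(ler_pM2l (x := n.+1%:R^-1)) ?invr_gt0 // mulrBr.
  by rewrite [r.+1%:R^-1 * _]mulrC mulKf ?gt_eqF.
have ar1 (e' u v w t : R) : t <= e' / 2 -> x <= w -> w - e' / 2 <= u ->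
  u - t <= v -> x - e' <= v by lra.
have ar2 (e' v w : R) : v <= w + e' / 2 -> w <= x + e' / 2 -> v <= x + e' by lra.
rewrite ler_distlC; apply/andP; split; last exact: ar2 h1 HL1.
exact: ar1 Hr CL h2 h3.
Qed.

End LogAverage.

Section Factorization.
Variables (R : realType) (k : nat) (A : alph k -> 'M[R]_2).
Hypothesis A_rank : forall i, (\rank (A i) == 1%N) || (A i \in unitmx).
Variables (d : measure_display) (Omega : measurableType d).
Variables (X : nat -> Omega -> alph k) (o : Omega).

Lemma cocycle_unit n :
  (forall l, (0 < l <= n)%N -> \rank (A (X l o)) != 1%N) ->
  cocycle_prod A X n o \in unitmx.
Proof.
elim: n => [|n IH] H /=; first exact: unitmx1.
rewrite unitmx_mul IH ?andbT; last by move=> l /andP[l0 ln]; apply: H; rewrite l0 leqW.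
by have := A_rank (X n.+1 o); rewrite (negbTE (H n.+1 _)) //= ltnS leqnn.
Qed.

(* From the first singular time on, the product is a rank one matrix whose
   range is spanned by the current direction. *)
Lemma opnorm_cocycle : (exists2 n, (0 < n)%N & \rank (A (X n o)) = 1%N) ->
  exists T, seen_singular A (past X T o) /\ exists2 c : R, 0 < c &
    forall n, (T <= n)%N -> opnorm (cocycle_prod A X n o) =
      c * \prod_(T <= l < n) growth A (past X l.+1 o).
Proof.
move=> ex; have ex' : exists n, (0 < n)%N && (\rank (A (X n o)) == 1%N).
  by have [n n0 r1] := ex; exists n; rewrite n0 r1 eqxx.
have [T /andP[T0 /eqP r1] Tmin] := ex_minnP ex'.
exists T; split.
  by case: T T0 r1 {Tmin} => // T _ r1 /=; rewrite r1 eqxx.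
case: T T0 r1 Tmin => // T _ r1 Tmin.
have [l l0 Al] := rank1_factor r1.
set M := cocycle_prod A X T o.
have uM : M \in unitmx.
  apply: cocycle_unit => m /andP[m0 mT]; apply/negP => rm.
  by have := Tmin m; rewrite m0 rm => /(_ isT); rewrite ltnNge mT.
have lM0 : l *m M != 0.
  by apply: contra l0 => /eqP e; rewrite -(mulmxK uM l) e mul0mx.
exists (vnorm (l *m M)^T).
  by rewrite lt_def vnorm_ge0 vnorm_eq0 trmx_eq0 lM0.
suff H n : (T < n)%N -> exists t : R,
    cocycle_prod A X n o = t *: (p1v (direction A (past X n o)) *m (l *m M)) /\
    `|t| = \prod_(T.+1 <= j < n) growth A (past X j.+1 o).
  by move=> n Tn; have [t [-> <-]] := H n Tn; rewrite opnorm_rank1 // mulrC.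
elim: n => // n IH; rewrite ltnS leq_eqVlt => /orP[/eqP <-|Tn].
  exists 1; rewrite big_geq // normr1 scale1r; split => //=.
  by rewrite -/M {1}Al /pact r1 eqxx mulmxA.
have [t [Ht1 Ht2]] := IH Tn.
have [t' Ht' nt'] := mulmx_pact (direction A (past X n o)) (A_rank (X n.+1 o)).
exists (t * t'); split.
  by rewrite /= Ht1 -scalemxAr (mulmxA (A _)) Ht' -scalemxAl scalerA.
by rewrite big_nat_recr //= normrM Ht2 nt'.
Qed.

Lemma seen_singular_later T n :
  seen_singular A (past X T o) -> (T <= n)%N -> seen_singular A (past X n o).
Proof.
move=> sT /subnK <-; elim: (n - T)%N => // m IH.
by rewrite addSn /seen_singular /= -/(seen_singular _ _) IH orbT.
Qed.

End Factorization.

Theorem theorem2p2 (R : realType) (k : nat)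
    (A : alph k -> 'M[R]_2) (p : alph k -> alph k -> R) (q : alph k -> R)
    (d : measure_display) (Omega : measurableType d)
    (Pr : probability Omega R) (X : nat -> Omega -> alph k) :
  (forall i, (\rank (A i) == 1%N) || (A i \in unitmx)) ->
  (exists i, \rank (A i) = 1%N) ->
  (exists i, A i \in unitmx) ->
  left_stochastic p ->
  primitive p ->
  (forall j, 0 <= q j) -> \sum_(j : alph k) q j = 1 ->
  (forall i, \sum_(j : alph k) p i j * q j = q i) ->
  markov_chain p Pr q X ->
  exists eta : probability (alph k * P1 R)%type R,
    Q_stationary p A eta /\
    (forall eta' : probability (alph k * P1 R)%type R,
        Q_stationary p A eta' -> forall S, measurable S -> eta' S = eta S) /\
    {ae Pr, forall o,
      ((n%:R^-1)%:E * elog (opnorm (cocycle_prod A X n o)))%E @[n --> \oo]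
        --> (\int[eta]_z Psi p A z)%E}.
Proof.
move=> A_rank [s s_sing] _ [p_ge0 p_sum1] p_prim q_ge0 q_sum1 q_stat X_chain.
have [eta st] := exists_stationary A_rank p_ge0 p_sum1 p_prim q_ge0 q_sum1 q_stat s_sing.
exists eta; split => //; split.
  by move=> eta' st'; exact: (stationary_unique A_rank p_ge0 p_sum1 p_prim s_sing st st').
have C_cvg := @Psi_mean_cvg _ _ A p p_ge0 p_sum1 eta.
have I_le L := integral_Psi_le A p_ge0 p_sum1 eta L.
have lln : {ae Pr, forall o, forall L,
    n%:R^-1 * \sum_(0 <= l < n) tln L (growth A (past X l.+1 o))
    @[n --> \oo] --> Psi_mean A p eta L}.
  apply: ae_foralln => L.
  exact: (trunc_lln A_rank p_ge0 p_sum1 p_prim q_ge0 q_sum1 s_sing X_chain st).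
have tails : {ae Pr, forall o, (\int[eta]_z Psi p A z)%E \is a fin_num ->
    forall r, exists L, forall L' n,
    \sum_(0 <= l < n) (seen_singular A (past X l o))%:R *
      (tln L (growth A (past X l.+1 o)) - tln (L + L') (growth A (past X l.+1 o)))
    <= r.+1%:R^-1 * n%:R}.
  case: (boolP ((\int[eta]_z Psi p A z)%E \is a fin_num)) => [fin|_]; last exact: aeW.
  have cle L : fine (\int[eta]_z Psi p A z)%E <= Psi_mean A p eta L.
    by rewrite -lee_fin fineK.
  have cv : Psi_mean A p eta L @[L --> \oo] --> fine (\int[eta]_z Psi p A z)%E.
    by move: C_cvg; rewrite -[X in _ --> X](fineK fin) => h; exact: (fine_cvg h).
  have := tail_control A_rank p_ge0 p_sum1 p_prim q_ge0 q_sum1 q_stat s_sing X_chain st cle cv.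
  by apply: filterS => o H _.
have times := exists_singular_time A_rank p_ge0 p_sum1 p_prim q_ge0 q_sum1 s_sing X_chain st.
move: lln tails times; apply: filterS3 => o lln tails times.
have [T [sT [c c0 Hc]]] := opnorm_cocycle A_rank times.
have a_ge0 l : 0 <= growth A (past X l.+1 o) by exact: vnorm_ge0.
have := @log_average R (fun l => growth A (past X l.+1 o)) (Psi_mean A p eta)
  (\int[eta]_z Psi p A z)%E c T c0 a_ge0 lln C_cvg I_le.
have tl : (\int[eta]_z Psi p A z)%E \is a fin_num -> forall r, exists L, forall L' n,
  \sum_(0 <= l < n) (T <= l)%:R * (tln L (growth A (past X l.+1 o)) -
    tln (L + L') (growth A (past X l.+1 o))) <= r.+1%:R^-1 * n%:R.
  move=> /tails H r; have [L HL] := H r; exists L => L' n.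
  apply: le_trans (HL L' n); apply: ler_sum => l _; apply: ler_wpM2r.
    by rewrite subr_ge0 tln_nonincr // leq_addr.
  by case: leqP => // Tl; rewrite (seen_singular_later sT Tl).
move=> /(_ tl) h; apply: (cvg_near_eq _ h); exists T => // n /= Tn.
by rewrite Hc.
Qed.
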